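(* Let $n\ge2$. For a rectangular box $\Omega\subset\mathbb{R}^n$ and $c\in(0,\mu_2)$, $\mu_2=\mu_2(\Omega)$, let $u_c$ be the solution of $$-\Delta u=cu \ \text{ in } \Omega,\qquad \frac{\partial u}{\partial\nu}=-1\ \text{ on }\partial\Omega ,$$ and let $u_{\mu_2}$ be a solution for $c=\mu_2$. Then for every rectangular box $\Omega\subset\mathbb{R}^n$, $$\lim_{c\to\mu_2^-}c\int_{\partial\Omega}u_c\,d\sigma=\mu_2\int_{\partial\Omega}u_{\mu_2}\,d\sigma\ \ge\ 2^n\,n(n-1)\left(\frac{P(\Omega)}{n2^n}\right)^{\frac{n-2}{n-1}}.$$
   Context: A rectangular box is a Cartesian product of $n$ bounded open intervals. $\mu_2$ is the second Neumann Laplacian eigenvalue of $\Omega$ (the first being $0$). Solutions are weak solutions in $H^1(\Omega)$: $\int_\Omega\nabla u_c\cdot\nabla\varphi\,dx+\int_{\partial\Omega}\varphi\,d\sigma=c\int_\Omega u_c\varphi\,dx$ for all $\varphi\in H^1(\Omega)$; for $c\in(0,\mu_2)$ the solution is unique, and for $c=\mu_2$ on a rectangular box solutions exist and differ by Neumann eigenfunctions of $\mu_2$, which have zero integral over $\partial\Omega$, so $\int_{\partial\Omega}u_{\mu_2}\,d\sigma$ is well defined. $\nu$ is the outer unit normal, $d\sigma$ surface measure, $P(\Omega)$ the perimeter of $\Omega$. *)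

(* Defs.v *)
From HB Require Import structures.
From mathcomp Require Import all_boot all_order all_algebra.
From mathcomp Require Import all_classical all_reals all_analysis.
Import Order.TTheory GRing.Theory Num.Theory.
Import numFieldNormedType.Exports.

Set Implicit Arguments.
Unset Strict Implicit.
Unset Printing Implicit Defensive.

Local Open Scope classical_set_scope.
Local Open Scope ring_scope.

Definition rV_display : measure_display.
Proof. exact: measure_tuple_display default_measure_display. Qed.

Section measurable_rV.
Context {R : realType} (n : nat).

Let coors : 'I_n -> 'rV[R]_n -> R := fun i x => x 0 i.

Let rV_set0 : g_sigma_preimage coors set0.
Proof. exact: sigma_algebra0. Qed.

Let rV_setC A : g_sigma_preimage coors A -> g_sigma_preimage coors (~` A).
Proof. exact: sigma_algebraC. Qed.

Let rV_bigcup (F : (set _)^nat) : (forall i, g_sigma_preimage coors (F i)) ->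
  g_sigma_preimage coors (\bigcup_i (F i)).
Proof. exact: sigma_algebra_bigcup. Qed.

(* The sigma-algebra generated by the n coordinates, i.e. the Borel sets. *)
HB.instance Definition _ := @isMeasurable.Build rV_display
  'rV[R]_n (g_sigma_preimage coors) rV_set0 rV_setC rV_bigcup.

Lemma measurable_coord (i : 'I_n) :
  measurable_fun [set: 'rV[R]_n] (fun x : 'rV[R]_n => x 0 i).
Proof.
move=> _ Y mY; rewrite setTI; apply: sub_sigma_algebra => /=.
rewrite -bigcup_seq/=; exists i => /=; first by rewrite mem_index_enum.
by exists Y => //; rewrite setTI.
Qed.

Lemma measurable_fun_rV d (T : measurableType d) (f : T -> 'rV[R]_n) :
  (forall i, measurable_fun [set: T] (fun x => f x 0 i)) ->
  measurable_fun [set: T] f.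
Proof.
move=> mf; have sub : g_sigma_preimage (fun i => coors i \o f) `<=` measurable.
  apply: smallest_sub; first exact: sigma_algebra_measurable.
  rewrite -bigcup_seq; apply: bigcup_sub => i _ A [B mB <-].
  exact: mf.
move: sub; rewrite g_sigma_preimage_comp => sub _ A mA.
by apply: sub; exists A.
Qed.

End measurable_rV.

(* The library's canonical sigma-finite structure on m1 \x m2 is shadowed by the
   one for products of probabilities. *)
Lemma sigma_finite_product_measure1 {R : realType} d1 d2
    (T1 : measurableType d1) (T2 : measurableType d2)
    (m1 : {sigma_finite_measure set T1 -> \bar R})
    (m2 : {sigma_finite_measure set T2 -> \bar R}) :
  sigma_finite setT (product_measure1 m1 m2).
Proof.
have /sigma_finiteP[F [TF ndF Foo]] := sigma_finiteT m1.
have /sigma_finiteP[G [TG ndG Goo]] := sigma_finiteT m2.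
exists (fun n => F n `*` G n).
  rewrite -setXTT TF TG predeqE => -[x y]; split.
    move=> [/= [n _ Fnx] [k _ Gky]]; exists (maxn n k) => //; split.
    - by move: x Fnx; exact/subsetPset/ndF/leq_maxl.
    - by move: y Gky; exact/subsetPset/ndG/leq_maxr.
  by move=> [n _ []/= ? ?]; split; exists n.
move=> k; have [? ?] := Foo k; have [? ?] := Goo k.
split; first exact: measurableX.
by rewrite product_measure1E// lte_mul_pinfty// ge0_fin_numE.
Qed.

Section bundle_sigma_finite.
Context {R : realType} d (T : measurableType d).
Variable m : {measure set T -> \bar R}.

Definition bundle_sigma_finite of sigma_finite setT m : set T -> \bar R := m.

Variable mS : sigma_finite setT m.

HB.instance Definition _ := Measure.on (bundle_sigma_finite mS).

HB.instance Definition _ :=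
  Measure_isSigmaFinite.Build _ _ _ (bundle_sigma_finite mS) mS.

End bundle_sigma_finite.

Section coordinates.
Context {R : realType}.

(* The point of R^n whose i-th coordinate is s and whose other coordinates are,
   in order, those of y. *)
Definition insert_coord n (i : 'I_n) (s : R) (y : 'rV[R]_n.-1) : 'rV[R]_n :=
  \row_j (if unlift i j is Some k then y 0 k else s).

Definition cons_coord n (p : (measurableTypeR R * 'rV[R]_n)%type) : 'rV[R]_n.+1 :=
  @insert_coord n.+1 ord0 p.1 p.2.

Lemma measurable_cons_coord n : measurable_fun setT (@cons_coord n).
Proof.
apply: measurable_fun_rV => i.
rewrite /cons_coord /insert_coord; case: (unliftP ord0 i) => [j ->|->].
  rewrite (_ : (fun _ => _) = (fun y : 'rV[R]_n => y 0 j) \o snd).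
    by apply: measurableT_comp => //; exact: measurable_coord.
  by apply/funext => p /=; rewrite mxE liftK.
rewrite (_ : (fun _ => _) = fst); first exact: measurable_fst.
by apply/funext => p /=; rewrite mxE unlift_none.
Qed.

Lemma sigma_finite_pushforward_cons_coord n
    (m : set (measurableTypeR R * 'rV[R]_n)%type -> \bar R) :
  sigma_finite setT m -> sigma_finite setT (pushforward m (@cons_coord n)).
Proof.
move=> [F TF mF].
pose uncons (x : 'rV[R]_n.+1) : (measurableTypeR R * 'rV[R]_n)%type :=
  (x 0 ord0, col' ord0 x).
have consK p : uncons (cons_coord p) = p.
  rewrite /uncons /cons_coord /insert_coord; case: p => s y /=.
  rewrite mxE unlift_none.
  by congr pair; apply/rowP => j; rewrite !mxE liftK.
have munc : measurable_fun setT uncons.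
  apply/measurable_fun_pairP; split; first exact: measurable_coord.
  apply: measurable_fun_rV => j; rewrite (_ : (fun _ => _) =
    fun x : 'rV[R]_n.+1 => x 0 (lift ord0 j)).
    exact: measurable_coord.
  by apply/funext => x /=; rewrite mxE.
exists (fun k => uncons @^-1` F k).
  by rewrite -preimage_bigcup -TF preimage_setT.
move=> k; have [mFk Fk] := mF k; split.
  by rewrite -[X in measurable X]setTI; exact: munc.
rewrite /pushforward -comp_preimage (_ : uncons \o _ = id) //.
by apply/funext => p /=; rewrite consK.
Qed.

End coordinates.

(* R^(n+1) is identified with R x R^n through the first coordinate. *)
Fixpoint leb {R : realType} n : set 'rV[R]_n -> \bar R :=
  match n with
  | 0 => dirac (0 : 'rV[R]_0)
  | m.+1 => pushforward (product_measure1 (@lebesgue_measure R) (@leb R m))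
                        (@cons_coord R m)
  end.

Arguments leb {R} n.

Section leb_measure.
Context {R : realType} (n : nat).

Lemma leb_sigma_finite_measure :
  exists m : {sigma_finite_measure set 'rV[R]_n -> \bar R}, leb n = m.
Proof.
elim: n => [|k [m mE]]; first by exists (dirac (0 : 'rV[R]_0)).
pose nu0 : {measure set 'rV[R]_k.+1 -> \bar R} :=
  measure_function_pushforward__canonical__measure_function_Measure
    (product_measure1 (@lebesgue_measure R) m) (@measurable_cons_coord R k).
have nuS : sigma_finite setT nu0.
  apply: sigma_finite_pushforward_cons_coord.
  exact: sigma_finite_product_measure1.
by exists (bundle_sigma_finite nuS); rewrite /= mE.
Qed.

Let leb0 : leb n (set0 : set 'rV[R]_n) = 0%E.
Proof. by have [m ->] := leb_sigma_finite_measure; rewrite measure0. Qed.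

Let leb_ge0 (A : set 'rV[R]_n) : (0 <= leb n A)%E.
Proof. by have [m ->] := leb_sigma_finite_measure; exact: measure_ge0. Qed.

Let leb_sigma_additive : semi_sigma_additive (@leb R n).
Proof.
by have [m ->] := leb_sigma_finite_measure; exact: measure_semi_sigma_additive.
Qed.

HB.instance Definition _ :=
  isMeasure.Build _ _ _ (@leb R n) leb0 leb_ge0 leb_sigma_additive.

Let leb_sigma_finite : sigma_finite setT (@leb R n).
Proof. by have [m ->] := leb_sigma_finite_measure; exact: sigma_finiteT. Qed.

HB.instance Definition _ :=
  Measure_isSigmaFinite.Build _ _ _ (@leb R n) leb_sigma_finite.

End leb_measure.

Definition box {R : realType} n (a b : 'rV[R]_n) : set 'rV[R]_n :=
  [set x | forall i, a 0 i < x 0 i < b 0 i].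

Definition square_integrable {R : realType} d (T : measurableType d)
    (mu : {measure set T -> \bar R}) (D : set T) (f : T -> R) : Prop :=
  measurable_fun D f /\ mu.-integrable D (fun x => (f x ^+ 2)%:E).

Section box.
Context {R : realType} (n : nat).
Implicit Types (a b : 'rV[R]_n) (u v w g phi : 'rV[R]_n -> R).

(* The 2n open faces cover the boundary up to a set of dimension n - 2; face i
   is parametrized isometrically by the (n-1)-dimensional box obtained by
   deleting the i-th coordinate. *)
Definition face a b (i : 'I_n) : set 'rV[R]_n.-1 := box (col' i a) (col' i b).

Definition boundary_int a b g : R :=
  \sum_(i < n)
    (\int[leb n.-1]_(y in face a b i) g (insert_coord i (a 0 i) y) +
     \int[leb n.-1]_(y in face a b i) g (insert_coord i (b 0 i) y)).

Definition perimeter a b : R := boundary_int a b (fun=> 1).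

Definition L2 a b u : Prop := square_integrable (leb n) (box a b) u.

Definition L2_boundary a b g : Prop := forall i : 'I_n,
  square_integrable (leb n.-1) (face a b i)
    (fun y => g (insert_coord i (a 0 i) y)) /\
  square_integrable (leb n.-1) (face a b i)
    (fun y => g (insert_coord i (b 0 i) y)).

Definition partial (i : 'I_n) phi : 'rV[R]_n -> R :=
  fun x => 'D_(delta_mx 0 i) phi x.

Definition C1 phi : Prop :=
  (forall x, differentiable phi x) /\ forall i, continuous (partial i phi).

Definition C1_compact_support (O : set 'rV[R]_n) phi : Prop :=
  C1 phi /\ exists K, [/\ compact K, K `<=` O & forall x, ~ K x -> phi x = 0].

(* Testing against C^1 or C^infinity functions of compact support is the same,
   by mollification. *)
Definition weak_gradient a b u (G : 'I_n -> 'rV[R]_n -> R) : Prop :=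
  forall i, L2 a b (G i) /\
    forall phi, C1_compact_support (box a b) phi ->
      \int[leb n]_(x in box a b) (u x * partial i phi x) =
      - \int[leb n]_(x in box a b) (G i x * phi x).

Definition H1 a b u : Prop := L2 a b u /\ exists G, weak_gradient a b u G.

(* The weak gradient, unique up to null sets; a junk value outside H^1. *)
Definition grad a b u : 'I_n -> 'rV[R]_n -> R :=
  xget (fun _ _ => 0) [set G | weak_gradient a b u G].

Definition dirichlet_form a b u v : R :=
  \int[leb n]_(x in box a b) (\sum_(i < n) grad a b u i x * grad a b v i x).

(* The trace operator is the continuous extension to H^1 of the restriction
   v |-> v|_boundary, defined on functions of class C^1 up to the boundary. *)
Definition is_trace a b u g : Prop :=
  L2_boundary a b g /\
  exists v : nat -> 'rV[R]_n -> R,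
    [/\ forall k, C1 (v k),
        (\int[leb n]_(x in box a b) (v k x - u x) ^+ 2) @[k --> \oo] --> (0 : R),
        forall i, (\int[leb n]_(x in box a b) (partial i (v k) x - grad a b u i x) ^+ 2)
                    @[k --> \oo] --> (0 : R)
      & boundary_int a b (fun x => (v k x - g x) ^+ 2) @[k --> \oo] --> (0 : R)].

(* The trace, unique up to null sets of the boundary; a function on R^n of which
   only the values on the faces matter. *)
Definition trace a b u : 'rV[R]_n -> R :=
  xget (fun=> 0) [set g | is_trace a b u g].

Definition neumann_eigenfunction a b (lambda : R) w : Prop :=
  H1 a b w /\
  forall phi, H1 a b phi ->
    dirichlet_form a b w phi =
      lambda * \int[leb n]_(x in box a b) (w x * phi x).

Definition lin_indep_ae a b k (w : 'I_k -> 'rV[R]_n -> R) : Prop :=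
  forall t : 'I_k -> R,
    {ae leb n, forall x, box a b x -> \sum_(j < k) t j * w j x = 0} ->
    forall j, t j = 0.

(* The k-th Neumann eigenvalue (k = 1, 2, ...), counted with multiplicity: the
   least mu below which, mu included, there are k independent eigenfunctions. *)
Definition neumann_eigenvalue a b (k : nat) : R :=
  inf [set mu | exists (lambda : 'I_k -> R) (w : 'I_k -> 'rV[R]_n -> R),
    (forall j, neumann_eigenfunction a b (lambda j) (w j) /\ lambda j <= mu) /\
    lin_indep_ae a b w].

(* Weak solutions of - Laplacian u = c u with outer normal derivative - 1. *)
Definition weak_solution a b (c : R) u : Prop :=
  H1 a b u /\
  forall phi, H1 a b phi ->
    dirichlet_form a b u phi + boundary_int a b (trace a b phi) =
    c * \int[leb n]_(x in box a b) (u x * phi x).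

End box.

(* Main.v *)
(* Write L_i for the half side lengths, r = sqrt c, and m for the centre of the
   box.  The function w(x) = sum_i cos (r (x_i - m_i)) / (r sin (r L_i)) is a
   weak solution, and the point is that every weak solution u has the same
   boundary integral.  Testing u with the products phi_k of Neumann cosines gives
   (c - lambda_k) int (u - w) phi_k = 0.  Since c <= mu_2 <= (pi / (2 L_i))^2,
   lambda_k = c forces phi_k to be a single cosine cos (pi (x_i - a_i) / (2 L_i)).
   The phi_k are total in L^2, so u is almost everywhere w plus a combination of
   such cosines; hence it is smooth and has a trace, and testing u with w and w
   with u gives the equality of the boundary integrals.

   No density theorem is needed.  Integration by parts against phi_k is obtained
   by cutting off near the faces, where the normal derivative of phi_k vanishes;
   and a vector field which is the outer normal on the boundary turns boundary
   integrals into integrals over the box which are continuous for the H^1 norm.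

   Green's formula gives
     c int_boundary w = sum_i (V / L_i) (r cot (r L_i)) + sum_(i != j) V / (L_i L_j)
   with V the volume.  At c = mu_2 the cotangents are nonnegative, and the lower
   bound for the last sum is Maclaurin's inequality between the elementary
   symmetric means of degrees n - 2 and n - 1 of the L_i. *)

Require Import Defs.
From mathcomp Require Import all_boot all_order all_algebra.
From mathcomp Require Import all_classical all_reals all_analysis.
From mathcomp Require Import measurable_realfun ring lra.
Import Order.TTheory GRing.Theory Num.Theory.
Import numFieldNormedType.Exports.

Set Implicit Arguments.
Unset Strict Implicit.
Unset Printing Implicit Defensive.

Local Open Scope classical_set_scope.
Local Open Scope ring_scope.

(** * Lebesgue measure on rectangles *)

Section rectangles.
Context {R : realType}.

(** Totality uses no Fourier series. The product-to-sum formula passes from cosines to polynomials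
    in a single cosine; that cosine is strictly monotone on its side of the box, so polynomials
    approximating a step function produce indicators of half-lines. One coordinate at a time this
    gives quadrants, which generate the Borel sets. Uniqueness of weak gradients follows from the
    same totality.

    [trace] is a choice, meaningful only where some trace has been exhibited. So the weak equation
    is tested with C^1 functions only, until u itself is known to agree almost everywhere with one.

    The cases c < mu_2 and c = mu_2 are one case, 0 < c <= mu_2. There 0 < r L_i <= pi / 2, so the
    sines in the formula for c int_boundary u stay positive up to and including mu_2, and the limit
    is an evaluation of a continuous function. Positivity of mu_2 comes from the existence of a
    solution at mu_2: at c = 0 the constant test function would make the perimeter vanish.

    In x_i = 1 / L_i the perimeter is V e_1(x) and the last sum is 2 V e_2(x), so Maclaurin's
    inequality involves only e_1, e_2 and the product of the x_i, and can be proved by adding one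
    variable at a time. *)

Definition rect n (Y : 'I_n -> set R) : set 'rV[R]_n :=
  [set x | forall i, Y i (x 0 i)].

Lemma measurable_rect n (Y : 'I_n -> set R) :
  (forall i, measurable (Y i)) -> measurable (rect Y).
Proof.
move=> mY; rewrite (_ : rect Y = \bigcap_(i in [set: 'I_n])
    [set x : 'rV[R]_n | Y i (x 0 i)]).
  apply: fin_bigcap_measurable => // i _.
  rewrite -[X in measurable X]setTI.
  exact: (measurable_coord i).
by apply/seteqP; split => [x Yx i _|x Yx i]; [exact: Yx | exact: Yx i I].
Qed.

(** The coordinate preimages which define the sigma-algebra are not stable under intersection.
    Rectangles are, as uniqueness of measures requires of a generating family. *)
Lemma rV_measurableE n : @measurable _ 'rV[R]_n =
  <<s [set A | exists2 Y : 'I_n -> set R, (forall i, measurable (Y i)) &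
                 A = rect Y] >>.
Proof.
apply/seteqP; split.
  apply: smallest_sub; first exact: smallest_sigma_algebra.
  move=> A; rewrite -bigcup_seq/= => -[i _ [B mB <-]].
  apply: sub_sigma_algebra => /=.
  exists (fun j => if j == i then B else setT).
    by move=> j; case: ifP.
  apply/seteqP; split => [x [_ /= Bx] j|x /= /(_ i)].
    by case: ifP => // /eqP ->.
  by rewrite eqxx.
apply: smallest_sub; first exact: sigma_algebra_measurable.
by move=> _ [Y mY ->]; exact: measurable_rect.
Qed.

Lemma rect_setI n (Y Z : 'I_n -> set R) :
  rect Y `&` rect Z = rect (fun i => Y i `&` Z i).
Proof.
by apply/seteqP; split => [x [Yx Zx] i|x YZx]; [split|split => i; have [] := YZx i].
Qed.

Lemma rect_itv_cover n : \bigcup_k rect (fun _ : 'I_n => `]- k%:R, k%:R[%classic) = setT.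
Proof.
rewrite -subTset => x _.
pose M := \sum_(i < n) `|x 0 i|.
exists (Num.truncn M).+1 => // i /=; rewrite in_itv/= -ltr_norml.
apply: (@le_lt_trans _ _ M); last exact: truncnS_gt.
by rewrite /M (bigD1 i)//= lerDl sumr_ge0.
Qed.

Lemma measurable_insert_coord m (i : 'I_m.+1) :
  measurable_fun setT (fun p : measurableTypeR R * 'rV[R]_m =>
    @insert_coord R m.+1 i p.1 p.2).
Proof.
apply: measurable_fun_rV => j.
rewrite /insert_coord; case: (unliftP i j) => [k ->|->].
  rewrite (_ : (fun _ => _) = (fun y : 'rV[R]_m => y 0 k) \o snd).
    by apply: measurableT_comp => //; exact: measurable_coord.
  by apply/funext => p /=; rewrite mxE liftK.
rewrite (_ : (fun _ => _) = fst); first exact: measurable_fst.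
by apply/funext => p /=; rewrite mxE unlift_none.
Qed.

Lemma preimage_insert_coord_rect m (i : 'I_m.+1) (Y : 'I_m.+1 -> set R) :
  (fun p : R * 'rV[R]_m => @insert_coord R m.+1 i p.1 p.2) @^-1` rect Y =
  Y i `*` rect (fun k => Y (lift i k)).
Proof.
apply/seteqP; split => [[s y] /= Yx|[s y] [/= Ys Yy] j].
  split => [|k]; first by have := Yx i; rewrite mxE unlift_none.
  by have := Yx (lift i k); rewrite mxE liftK.
by rewrite mxE; case: (unliftP i j) => [k ->|->//]; exact: Yy.
Qed.

Lemma leb_rect n (Y : 'I_n -> set R) : (forall i, measurable (Y i)) ->
  leb n (rect Y) = (\prod_(i < n) lebesgue_measure (Y i))%E.
Proof.
elim: n Y => [|n IH] Y mY.
  by rewrite big_ord0 /leb diracE mem_set// => -[].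
rewrite /leb -/leb /pushforward /cons_coord.
rewrite (preimage_insert_coord_rect ord0 Y) product_measure1E//.
- by rewrite [LHS]/= IH ?big_ord_recl.
- exact: mY.
- by apply: measurable_rect => k; exact: mY.
Qed.

(** [leb] singles out the first coordinate, whereas the faces need every coordinate i. Both measures
    give a rectangle the product of the lengths of its sides, and the cubes ]-k, k[^n, of finite
    measure, exhaust the space. *)
Lemma pushforward_insert_coord m (i : 'I_m.+1) (A : set 'rV[R]_m.+1) :
  measurable A ->
  leb m.+1 A = pushforward (product_measure1 (@lebesgue_measure R) (@leb R m))
    (fun p : measurableTypeR R * 'rV[R]_m => @insert_coord R m.+1 i p.1 p.2) A.
Proof.
pose nu : {measure set 'rV[R]_m.+1 -> \bar R} :=
  measure_function_pushforward__canonical__measure_function_Measure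
    (product_measure1 (@lebesgue_measure R) (@leb R m)) (measurable_insert_coord i).
move=> mA; have -> : pushforward (product_measure1 (@lebesgue_measure R) (@leb R m))
    (fun p : measurableTypeR R * 'rV[R]_m => @insert_coord R m.+1 i p.1 p.2) A =
    nu A by [].
apply: (@measure_unique _ R _ _ (fun k => rect (fun _ : 'I_m.+1 => `]- k%:R, k%:R[%classic))
  (@rV_measurableE m.+1) _ _ _ (@leb R m.+1) nu _ _ _ mA).
- move=> _ _ [Y mY ->] [Z mZ ->]; rewrite rect_setI /=.
  by exists (fun i => Y i `&` Z i) => // j; exact: measurableI.
- by move=> k; exists (fun=> `]- k%:R, k%:R[%classic).
- exact: rect_itv_cover.
- move=> _ [Y mY ->].
  rewrite [LHS](_ : _ = leb m.+1 (rect Y))// leb_rect// /nu /= /pushforward.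
  rewrite preimage_insert_coord_rect product_measure1E//; last 2 first.
  - exact: mY.
  - by apply: measurable_rect => k; exact: mY.
  rewrite [RHS](_ : _ = lebesgue_measure (Y i) *
    leb m (rect (fun k => Y (lift i k))))%E//.
  rewrite leb_rect// (bigD1 i)//=; congr (_ * _)%E.
  rewrite (reindex_omap (lift i) (unlift i))/=.
    apply: eq_bigl => k /=; rewrite liftK eqxx andbT.
    by rewrite eq_sym neq_lift.
  by move=> k; case: unliftP => [j ->//|->]; rewrite eqxx.
- move=> k; rewrite [ltLHS](_ : _ = leb m.+1 (rect (fun _ : 'I_m.+1 =>
    `]- k%:R, k%:R[%classic)))// leb_rect//.
  rewrite big_const card_ord; elim: (m.+1) => [|j IH]; first by rewrite ltry.
  rewrite iterS lte_mul_pinfty//.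
  by rewrite lebesgue_measure_itv/=; case: ifP.
Qed.

End rectangles.

(** * Square integrable functions *)

Section square_integrable_theory.
Context {R : realType} d (T : measurableType d).
Variables (mu : {measure set T -> \bar R}) (D : set T).
Hypotheses (mD : measurable D) (muD : (mu D < +oo)%E).
Implicit Types f g : T -> R.

Local Notation ig f := (mu.-integrable D (EFin \o f)).
Local Notation sqi := (square_integrable mu D).

Lemma ig_measurable f : ig f -> measurable_fun D f.
Proof. by move=> /measurable_int /measurable_EFinP. Qed.

Lemma ig_le f g : measurable_fun D f -> (forall x, D x -> `|f x| <= g x) ->
  ig g -> ig f.
Proof.
move=> mf fg; apply: le_integrable => //; first exact/measurable_EFinP.
by move=> x Dx /=; rewrite lee_fin (le_trans (fg _ Dx))// ler_norm.
Qed.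

Lemma igD f g : ig f -> ig g -> ig (fun x => f x + g x).
Proof. by move=> f1 g1; apply: integrableD f1 g1. Qed.

Lemma igB f g : ig f -> ig g -> ig (fun x => f x - g x).
Proof. by move=> f1 g1; apply: integrableB f1 g1. Qed.

Lemma igZ k f : ig f -> ig (fun x => k * f x).
Proof. by move=> f1; apply: integrableZl f1. Qed.

Lemma ig_sum (I : Type) (r : seq I) (F : I -> T -> R) :
  (forall i, ig (F i)) -> ig (fun x => \sum_(i <- r) F i x).
Proof.
move=> iF; elim: r => [|i r IH].
  apply: (@eq_integrable _ _ _ _ _ mD (cst 0%E)); last exact: integrable0.
  by move=> x _ /=; rewrite big_nil.
apply: (@eq_integrable _ _ _ _ _ mD (EFin \o (fun x => F i x + \sum_(j <- r) F j x))).
  by move=> x _ /=; rewrite big_cons.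
exact: igD.
Qed.

Lemma Rintegral_sum (I : Type) (r : seq I) (F : I -> T -> R) :
  (forall i, ig (F i)) ->
  \int[mu]_(x in D) (\sum_(i <- r) F i x) = \sum_(i <- r) \int[mu]_(x in D) F i x.
Proof.
move=> iF; elim: r => [|i r IH].
  rewrite big_nil -[RHS](mul0r (fine (mu D))) -(Rintegral_cst mu mD 0).
  by apply: eq_Rintegral => x _; rewrite big_nil.
rewrite big_cons -IH -RintegralD//; last exact: ig_sum.
by apply: eq_Rintegral => x _; rewrite big_cons.
Qed.

Lemma ig_bounded f C : measurable_fun D f -> (forall x, D x -> `|f x| <= C) ->
  ig f.
Proof.
move=> mf fC; apply: measurable_bounded_integrable => //.
exists C; split; first exact: num_real.
by move=> M CM x Dx; apply: le_trans (fC _ Dx) _; exact: ltW.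
Qed.

Lemma ig_cst k : ig (fun=> k).
Proof. by apply: (@ig_bounded _ `|k|). Qed.

Lemma ig_mulbounded f g C : ig f -> measurable_fun D g ->
  (forall x, D x -> `|g x| <= C) -> ig (fun x => f x * g x).
Proof.
move=> f1 mg gC; apply: (@ig_le _ (fun x => C * `|f x|)).
- by apply: measurable_funM => //; exact: ig_measurable.
- by move=> x Dx; rewrite normrM mulrC ler_wpM2r// gC.
- by apply: igZ; apply: integrable_norm.
Qed.

Lemma sqi_mul f g : sqi f -> sqi g -> ig (fun x => f x * g x).
Proof.
move=> [mf f2] [mg g2]; apply: (@ig_le _ (fun x => f x ^+ 2 + g x ^+ 2)).
- exact: measurable_funM.
- move=> x _; rewrite normrM -(real_normK (num_real (f x))) -(real_normK (num_real (g x))).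
  have := sqr_ge0 (`|f x| - `|g x|); rewrite sqrrB.
  have := normr_ge0 (f x); have := normr_ge0 (g x); nra.
- exact: (igD f2 g2).
Qed.

Lemma sqi_bounded f C : measurable_fun D f -> (forall x, D x -> `|f x| <= C) ->
  sqi f.
Proof.
move=> mf fC; split => //; apply: (@ig_bounded _ (C ^+ 2)).
  exact: measurable_funX.
move=> x Dx; rewrite normrX; have fxC := fC x Dx.
by apply: lerXn2r => //; rewrite nnegrE// (le_trans _ fxC).
Qed.

Lemma sqi_ig f : sqi f -> ig f.
Proof.
move=> f2; apply: (@eq_integrable _ _ _ _ _ mD (EFin \o (fun x => f x * 1))).
  by move=> x _ /=; rewrite mulr1.
by apply: sqi_mul => //; apply: (@sqi_bounded _ 1) => // x _; rewrite normr1.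
Qed.

Lemma sqiZ k f : sqi f -> sqi (fun x => k * f x).
Proof.
move=> [mf f2]; split; first exact: measurable_funM.
apply: (@eq_integrable _ _ _ _ _ mD (EFin \o (fun x => k ^+ 2 * f x ^+ 2))).
  by move=> x _ /=; rewrite exprMn.
exact: igZ.
Qed.

Lemma sqiD f g : sqi f -> sqi g -> sqi (fun x => f x + g x).
Proof.
move=> sf sg; have fg := sqi_mul sf sg; move: sf sg => [mf f2] [mg g2].
split; first exact: measurable_funD.
apply: (@eq_integrable _ _ _ _ _ mD
   (EFin \o (fun x => f x ^+ 2 + (2 * (f x * g x) + g x ^+ 2)))).
  by move=> x _ /=; congr (_%:E); ring.
by apply: igD => //; apply: igD => //; exact: igZ.
Qed.

Lemma sqiB f g : sqi f -> sqi g -> sqi (fun x => f x - g x).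
Proof.
move=> sf sg; have := sqiD sf (sqiZ (-1) sg).
by under [in X in _ -> X]eq_fun do rewrite -mulN1r.
Qed.

(** The integral of (f + t g)^2 is a nonnegative polynomial A + 2 t X + t^2 B. Its minimiser t = - X
    / B gives the claim; if B = 0 and X were nonzero, t = - (A + 1) / (2 X) would give the value
    -1. *)
Lemma cauchy_schwarz f g : sqi f -> sqi g ->
  (\int[mu]_(x in D) (f x * g x)) ^+ 2 <=
  (\int[mu]_(x in D) (f x ^+ 2)) * (\int[mu]_(x in D) (g x ^+ 2)).
Proof.
move=> sf sg; have fg := sqi_mul sf sg.
have f2 : ig (fun x => f x ^+ 2) by case: sf.
have g2 : ig (fun x => g x ^+ 2) by case: sg.
set A := \int[mu]_(x in D) (f x ^+ 2); set B := \int[mu]_(x in D) (g x ^+ 2).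
set X := \int[mu]_(x in D) (f x * g x).
have B0 : 0 <= B by apply: Rintegral_ge0 => x _; exact: sqr_ge0.
have A0 : 0 <= A by apply: Rintegral_ge0 => x _; exact: sqr_ge0.
have key t : 0 <= A + t * (2 * X) + t ^+ 2 * B.
  have -> : A + t * (2 * X) + t ^+ 2 * B = \int[mu]_(x in D) ((f x + t * g x) ^+ 2).
    rewrite /A /B /X -RintegralZl// -RintegralZl//; last exact: igZ.
    rewrite -RintegralZl// -RintegralD//; last by do 2 apply: igZ.
    rewrite -RintegralD//; last 2 first.
      by apply: igD => //; do 2 apply: igZ.
      exact: igZ.
    by apply: eq_Rintegral => x _; ring.
  by apply: Rintegral_ge0 => x _; exact: sqr_ge0.
have [B_eq0|Bn0] := eqVneq B 0.
  rewrite B_eq0 mulr0; have [->|Xn0] := eqVneq X 0; first by rewrite expr0n.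
  have := key (- (A + 1) / (2 * X)); rewrite B_eq0 mulr0 addr0 -mulrA mulVf ?mulr1; last first.
    by rewrite mulf_neq0// pnatr_eq0.
  by rewrite opprD addrA subrr sub0r oppr_ge0 ler10.
have B_gt0 : 0 < B by rewrite lt_neqAle eq_sym Bn0.
have := key (- X / B).
have -> : A + - X / B * (2 * X) + (- X / B) ^+ 2 * B = A - X ^+ 2 / B by field.
by rewrite subr_ge0 ler_pdivrMr.
Qed.

(** This carries integral identities from the C^1 approximants in [is_trace] to their limit. *)
Lemma cvg_Rintegral_mul_L2 (f_ : nat -> T -> R) f g :
  (forall k, sqi (f_ k)) -> sqi f -> sqi g ->
  (\int[mu]_(x in D) (f_ k x - f x) ^+ 2) @[k --> \oo] --> (0 : R) ->
  (\int[mu]_(x in D) (f_ k x * g x)) @[k --> \oo] --> \int[mu]_(x in D) (f x * g x).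
Proof.
move=> sf_ sf sg f_f.
set B := \int[mu]_(x in D) (g x ^+ 2).
have h : (Num.sqrt ((\int[mu]_(x in D) (f_ k x - f x) ^+ 2) * B)) @[k --> \oo] --> (0 : R).
  have h0 : ((\int[mu]_(x in D) (f_ k x - f x) ^+ 2) * B) @[k --> \oo] --> (0 : R).
    by rewrite -[X in _ --> X](mul0r B); apply: cvgM => //; exact: cvg_cst.
  by have := cvg_comp _ _ h0 (@sqrt_continuous R 0); rewrite sqrtr0.
apply/cvgrPdist_le => e e0.
have /cvgrPdist_le/(_ e e0) := h.
apply: filterS => k; rewrite sub0r normrN ger0_norm ?sqrtr_ge0// => h1.
apply: le_trans h1.
rewrite -RintegralB//; [|exact: sqi_mul|exact: sqi_mul].
rewrite -sqrtr_sqr ler_wsqrtr//.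
rewrite (_ : \int[mu]_(x in D) _ = \int[mu]_(x in D) ((f x - f_ k x) * g x)); last first.
  by apply: eq_Rintegral => x _; ring.
apply: le_trans (cauchy_schwarz _ _) _ => //; first exact: sqiB.
by rewrite (_ : \int[mu]_(x in D) _ = \int[mu]_(x in D) ((f_ k x - f x) ^+ 2))//;
  apply: eq_Rintegral => x _; ring.
Qed.

Lemma bounded_convergence f (g_ : nat -> T -> R) g C : ig f ->
  (forall k, measurable_fun D (g_ k)) ->
  (forall k x, D x -> `|g_ k x| <= C) ->
  (forall x, D x -> g_ ^~ x @ \oo --> g x) ->
  (\int[mu]_(x in D) (f x * g_ k x)) @[k --> \oo] --> \int[mu]_(x in D) (f x * g x).
Proof.
move=> f1 mg gC g_g.
have mf := ig_measurable f1.
have mg' : measurable_fun D g by exact: (measurable_fun_cvg _ g_g).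
have [] := @dominated_convergence _ T R mu D mD
  (fun k x => (f x * g_ k x)%:E) (fun x => (f x * g x)%:E)
  (fun x => (C * `|f x|)%:E).
- by move=> k; apply/measurable_EFinP; exact: measurable_funM.
- by apply/measurable_EFinP; exact: measurable_funM.
- apply: aeW => x Dx; apply: cvg_EFin; first exact: nearW.
  by apply: cvgM; [exact: cvg_cst|exact: g_g].
- by apply: igZ; exact: integrable_norm.
- apply: aeW => x k Dx; rewrite /= lee_fin normrM mulrC ler_wpM2r//.
  exact: gC.
move=> i1 _ h; apply: fine_cvg; rewrite fineK//.
exact: (integrable_fin_num mD i1).
Qed.

Lemma eq_Rintegral_ae f g : measurable_fun D f -> measurable_fun D g ->
  {ae mu, forall x, D x -> f x = g x} ->
  \int[mu]_(x in D) f x = \int[mu]_(x in D) g x.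
Proof.
move=> mf mg fg; congr fine; apply: ae_eq_integral => //.
- exact/measurable_EFinP.
- exact/measurable_EFinP.
- by apply: filterS fg => x fg Dx; rewrite fg.
Qed.

Lemma ae0_Rintegral_sqr f : sqi f -> \int[mu]_(x in D) (f x ^+ 2) = 0 ->
  {ae mu, forall x, D x -> f x = 0}.
Proof.
move=> [mf f2] f0.
have mf2 : measurable_fun D (EFin \o (fun x => f x ^+ 2)).
  by apply/measurable_EFinP; exact: measurable_funX.
have : (\int[mu]_(x in D) `|(f x ^+ 2)%:E| = 0)%E.
  under eq_integral do rewrite gee0_abs ?lee_fin ?sqr_ge0//.
  by rewrite -[LHS]fineK ?(integrable_fin_num mD f2)//; congr (_%:E).
move/(ae_eq_integral_abs mu mD mf2); apply: filterS => x h Dx.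
by have /= [/eqP] := h Dx; rewrite sqrf_eq0 => /eqP.
Qed.

End square_integrable_theory.

(** * Fubini's theorem and Green's formula on a box *)

Section box_theory.
Context {R : realType}.

Lemma boxE n (a b : 'rV[R]_n) :
  box a b = rect (fun i => `]a 0 i, b 0 i[%classic).
Proof.
by apply/seteqP; split => x xab i; have := xab i; rewrite /= in_itv/=.
Qed.

Lemma measurable_box n (a b : 'rV[R]_n) : measurable (box a b).
Proof. by rewrite boxE; exact: measurable_rect. Qed.

Lemma leb_box n (a b : 'rV[R]_n) : (forall i, a 0 i <= b 0 i) ->
  leb n (box a b) = (\prod_(i < n) (b 0 i - a 0 i))%:E.
Proof.
move=> ab; rewrite boxE leb_rect// -prodEFin; apply: eq_bigr => i _.
rewrite lebesgue_measure_itv/= lte_fin; have := ab i.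
by rewrite le_eqVlt => /predU1P[->|->]; rewrite ?ltxx ?subrr ?EFinB.
Qed.

Lemma leb_box_lty n (a b : 'rV[R]_n) : (leb n (box a b) < +oo)%E.
Proof.
have [ab|] := pselect (forall i, a 0 i <= b 0 i).
  by rewrite leb_box// ltry.
move=> /existsNP[i /negP]; rewrite -ltNge => ba.
rewrite (_ : box a b = set0) ?measure0//.
apply/seteqP; split => // x /(_ i) /andP[ax xb].
by have := lt_trans ax xb; rewrite ltNge (ltW ba).
Qed.

Lemma ltr_dist_near (u v w t r : R) : u - t < w -> w < u + t -> w - t < v ->
  v < w + t -> 2 * t < r -> - r < u - v < r.
Proof. by move=> *; apply/andP; split; lra. Qed.

Lemma rV_ball_itv n (x y : 'rV[R]_n) (e : R) : 0 < e ->
  (forall j, `|x 0 j - y 0 j| < e) -> ball x e y.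
Proof. by move=> e0 h; split => // i j; rewrite (ord1 i); exact: h. Qed.

(** Connects the topology of row vectors with the sigma-algebra generated by the coordinates: an
    open set is a countable union of cubes with rational centres and radii 1 / (k + 1). It is what
    makes continuous functions measurable. *)
Lemma open_rV_rational n (U : set 'rV[R]_n) : open U ->
  U = \bigcup_(p in [set: 'rV[rat]_n * nat])
    [set x : 'rV[R]_n |
      rect (fun j => `](ratr (p.1 0 j) - p.2.+1%:R^-1), (ratr (p.1 0 j) + p.2.+1%:R^-1)[%classic) `<=` U /\
      rect (fun j => `](ratr (p.1 0 j) - p.2.+1%:R^-1), (ratr (p.1 0 j) + p.2.+1%:R^-1)[%classic) x].
Proof.
move=> oU; apply/seteqP; split => [x Ux|x [p _ [pU px]]]; last exact: pU.
have := open_nbhs_nbhs (conj oU Ux).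
move=> /nbhs_ballP[e /= e0 eU].
(* The cube has radius 1 / (k + 1) and contains x, so its points are within 2 / (k + 1) < e of x. *)
pose k := Num.truncn (2 / e).
have k0 : 0 < k.+1%:R^-1 :> R by rewrite invr_gt0.
have ke : 2 * k.+1%:R^-1 < e :> R.
  by rewrite ltr_pdivrMr// mulrC -ltr_pdivrMr//; exact: truncnS_gt.
clearbody k.
have /choice[q qx] : forall j, exists q : rat,
    ratr q \in `](x 0 j - k.+1%:R^-1), (x 0 j + k.+1%:R^-1)[.
  by move=> j; apply: rat_in_itvoo; rewrite ltrD2l gtrN.
exists (\row_j q j, k) => //=; split.
  move=> y /= yq; apply: eU; apply: rV_ball_itv => // j.
  have := yq j; have := qx j; rewrite /= mxE !in_itv/= => /andP[h1 h2] /andP[h3 h4].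
  by rewrite ltr_norml (ltr_dist_near h1 h2 h3 h4 ke).
move=> j /=; have := qx j; rewrite /= mxE !in_itv/= => /andP[h1 h2].
by rewrite ltrBlDr h2 -ltrBlDr h1.
Qed.

Lemma continuous_measurable_rV n (f : 'rV[R]_n -> R) :
  continuous f -> measurable_fun setT f.
Proof.
move=> cf; apply: (measurability _ (RGenOInfty.measurableE R)).
move=> _ [_ [x ->] <-]; rewrite setTI.
rewrite (@open_rV_rational _ (f @^-1` _)); last first.
  by apply: open_comp => //; exact: interval_open.
apply: countable_bigcupT_measurable => // p.
set S := rect _; have mS : measurable S by apply: measurable_rect => j.
have [h|h] := pselect (S `<=` f @^-1` `]x, +oo[).
  rewrite (_ : [set _ | _] = S)//.
  by apply/seteqP; split => [y []//|y Sy]; split.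
rewrite (_ : [set _ | _] = set0)//.
by apply/seteqP; split => // y [].
Qed.

Lemma continuous_bounded_box n (a b : 'rV[R]_n) (f : 'rV[R]_n -> R) :
  continuous f ->
  exists C, forall x : 'rV[R]_n, (forall i, a 0 i <= x 0 i <= b 0 i) -> `|f x| <= C.
Proof.
move=> cf.
pose K : set 'rV[R]_n := [set x | forall i, `[a 0 i, b 0 i]%classic (x ord0 i)].
have cK : compact K.
  exact: (rV_compact (A := fun i => `[a 0 i, b 0 i]%classic) (fun i => @segment_compact _ _ _)).
have : compact (f @` K) by apply: continuous_compact => //; exact: continuous_subspaceT.
move/compact_bounded => [M [_ MK]]; exists (M + 1) => x xab.
apply: (MK (M + 1)); first by rewrite ltrDl.
by exists x => // i; rewrite /= in_itv/=; exact: xab.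
Qed.

Lemma continuous_ig_box n (a b : 'rV[R]_n) (f : 'rV[R]_n -> R) :
  continuous f -> (leb n).-integrable (box a b) (EFin \o f).
Proof.
move=> cf; have [C fC] := continuous_bounded_box a b cf.
apply: (ig_bounded (measurable_box a b) (leb_box_lty a b) (C := C)).
  by apply: measurable_funTS; exact: continuous_measurable_rV.
by move=> x xab; apply: fC => i; have /andP[/ltW -> /ltW ->] := xab i.
Qed.

Lemma continuous_sqi_box n (a b : 'rV[R]_n) (f : 'rV[R]_n -> R) :
  continuous f -> L2 a b f.
Proof.
move=> cf; have [C fC] := continuous_bounded_box a b cf.
apply: (sqi_bounded (measurable_box a b) (leb_box_lty a b) (C := C)).
  by apply: measurable_funTS; exact: continuous_measurable_rV.
by move=> x xab; apply: fC => i; have /andP[/ltW -> /ltW ->] := xab i.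
Qed.

Lemma insert_coord_same m (i : 'I_m.+1) (s : R) y : @insert_coord R m.+1 i s y 0 i = s.
Proof. by rewrite mxE unlift_none. Qed.

Lemma insert_coord_lift m (i : 'I_m.+1) (s : R) y (k : 'I_m) :
  @insert_coord R m.+1 i s y 0 (lift i k) = y 0 k.
Proof. by rewrite mxE liftK. Qed.

Lemma insert_coordD m (i : 'I_m.+1) (s h : R) y :
  @insert_coord R m.+1 i (h + s) y = h *: delta_mx 0 i + @insert_coord R m.+1 i s y.
Proof.
apply/rowP => j; rewrite !mxE eqxx/=.
case: (unliftP i j) => [k ->|->].
  by rewrite eq_sym (negbTE (neq_lift _ _)) mulr0 add0r.
by rewrite eqxx mulr1.
Qed.

Lemma box_insert_coord m (i : 'I_m.+1) (a b : 'rV[R]_m.+1) s (y : 'rV[R]_m) :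
  box a b (@insert_coord R m.+1 i s y) <->
  (a 0 i < s < b 0 i) /\ box (col' i a) (col' i b) y.
Proof.
split=> [h|[h1 h2] j].
  split; first by have := h i; rewrite insert_coord_same.
  by move=> k; have := h (lift i k); rewrite insert_coord_lift !mxE.
case: (unliftP i j) => [k ->|->]; last by rewrite insert_coord_same.
by have := h2 k; rewrite insert_coord_lift !mxE.
Qed.

Lemma insert_coord_continuous m (i : 'I_m.+1) (y : 'rV[R]_m) :
  continuous (fun s : R => @insert_coord R m.+1 i s y).
Proof.
rewrite (_ : (fun _ => _) = fun s : R => s *: delta_mx 0 i + @insert_coord R m.+1 i 0 y).
  move=> s; apply: cvgD; last exact: cvg_cst.
  by apply: cvgZr_tmp; exact: cvg_id.
by apply/funext => s; rewrite -insert_coordD addr0.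
Qed.

Lemma insert_coord_continuous2 m (i : 'I_m.+1) (s : R) :
  continuous (fun y : 'rV[R]_m => @insert_coord R m.+1 i s y).
Proof.
move=> y A /nbhs_ballP[e e0 eA]; apply/nbhs_ballP; exists e => // z [_ yz].
apply: eA; split=> // i' j; rewrite (ord1 i') {i'} !mxE.
by case: unliftP => [k _|_]; [exact: yz|exact: ballxx].
Qed.

Lemma Rintegral_box_insert m (i : 'I_m.+1) (a b : 'rV[R]_m.+1) (f : 'rV[R]_m.+1 -> R) :
  continuous f ->
  \int[leb m.+1]_(x in box a b) f x =
  \int[leb m]_(y in face a b i)
    \int[lebesgue_measure]_(s in `]a 0 i, b 0 i[) f (@insert_coord R m.+1 i s y).
Proof.
move=> cf; have mf := continuous_measurable_rV cf.
have mab : measurable (box a b) := measurable_box a b.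
have mface : measurable (face a b i) := measurable_box (col' i a) (col' i b).
pose ins := fun p : measurableTypeR R * 'rV[R]_m => @insert_coord R m.+1 i p.1 p.2.
have mins : measurable_fun setT ins := measurable_insert_coord i.
(* Extension by zero moves the integral to the whole space, where the change of variables and
   Fubini's theorem apply; slices outside the face then contribute nothing. *)
pose g : 'rV[R]_m.+1 -> \bar R := (EFin \o f) \_ (box a b).
have mg : measurable_fun setT g.
  by apply/(measurable_restrict _ _ _).1 => //; rewrite setTI; exact/measurable_funTS/measurable_EFinP.
pose mu := (@lebesgue_measure R \x @leb R m)%E.
have gi : (mu).-integrable setT (g \o ins).
  apply/integrableP; split; first exact: measurableT_comp.
  have := continuous_ig_box a b cf; rewrite (integrable_mkcond _ mab) => /integrableP[_].
  rewrite (eq_measure_integral (pushforward mu ins)); last first.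
    by move=> A mA _; exact: (pushforward_insert_coord i mA).
  rewrite ge0_integral_pushforward//.
  exact: measurableT_comp.
rewrite /Rintegral integral_mkcond -/g.
rewrite (eq_measure_integral (pushforward mu ins)); last first.
  by move=> A mA _; exact: (pushforward_insert_coord i mA).
rewrite integral_pushforward//.
rewrite preimage_setT -(integral21_prod_meas1 gi).
congr fine; rewrite [RHS]integral_mkcond; apply: eq_integral => y _.
rewrite patchE; case: ifPn => yF.
  have yF' : face a b i y by rewrite inE in yF.
  rewrite fineK.
    rewrite [RHS]integral_mkcond; apply: eq_integral => s _.
    rewrite /g /= !patchE /ins /=; case: ifPn; case: ifPn => //; rewrite ?notin_setE ?inE /= ?in_itv/=.
      by move=> h /box_insert_coord[].
    by move=> h h'; exfalso; apply: h'; apply/box_insert_coord.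
  have : lebesgue_measure.-integrable `[a 0 i, b 0 i]
      (EFin \o (fun s => f (@insert_coord R m.+1 i s y))).
    apply: continuous_compact_integrable; first exact: segment_compact.
    apply: continuous_subspaceT => s.
    by apply: (continuous_comp (@insert_coord_continuous m i y s)); exact: cf.
  move=> fi; apply: integrable_fin_num => //.
  by apply: integrableS fi => //; exact: subset_itv_oo_cc.
apply: integral0_eq => s _; rewrite /g /= patchE; case: ifPn => //; rewrite inE.
by move=> /box_insert_coord[_ h]; move: yF; rewrite notin_setE.
Qed.

Lemma derive_insert_coord m (i : 'I_m.+1) (v : 'rV[R]_m.+1 -> R) s y :
  differentiable v (@insert_coord R m.+1 i s y) ->
  is_derive (s : R) (1 : R) (fun s => v (@insert_coord R m.+1 i s y))
    (partial i v (@insert_coord R m.+1 i s y)).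
Proof.
move=> /(@diff_derivable _ _ _ _ _ (delta_mx 0 i)).
have E : (fun h : R => h^-1 *: ((v \o shift (@insert_coord R m.+1 i s y)) (h *: delta_mx 0 i) -
   v (@insert_coord R m.+1 i s y))) =
  (fun h : R => h^-1 *: (((fun s => v (@insert_coord R m.+1 i s y)) \o shift s) (h *: 1) -
   v (@insert_coord R m.+1 i s y))).
  apply/funext => h; congr (_ *: (_ - _)).
  by rewrite /= -insert_coordD /GRing.scale/= mulr1.
move=> dv; apply: DeriveDef.
  by move: dv; rewrite /derivable E.
by rewrite /partial /derive E.
Qed.

(** The divergence theorem for the field v F(x_i) e_i: the integrand is its divergence, integrated
    along lines in direction i. With F = 1 it gives integration by parts; with F equal to -1 and 1
    at the two ends it turns boundary integrals into integrals over the box. *)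
Lemma green m (i : 'I_m.+1) (a b : 'rV[R]_m.+1) (v : 'rV[R]_m.+1 -> R) (F F' : R -> R) :
  a 0 i < b 0 i -> C1 v ->
  (forall s, is_derive (s : R) (1 : R) F (F' s)) -> continuous F' ->
  \int[leb m.+1]_(x in box a b) (partial i v x * F (x 0 i) + v x * F' (x 0 i)) =
  \int[leb m]_(y in face a b i)
    (v (@insert_coord R m.+1 i (b 0 i) y) * F (b 0 i) -
     v (@insert_coord R m.+1 i (a 0 i) y) * F (a 0 i)).
Proof.
move=> ab [dv cv] dF cF'.
have cF : continuous F.
  move=> s; apply: differentiable_continuous; rewrite -derivable1_diffP.
  by have [] := dF s.
have cv0 : continuous v by move=> x; exact: differentiable_continuous.
have ci : continuous (fun x : 'rV[R]_m.+1 => x 0 i) by move=> x; exact: coord_continuous.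
have cFi : continuous (fun x : 'rV[R]_m.+1 => F (x 0 i)).
  by move=> x; apply: (continuous_comp (ci x)); exact: cF.
have cF'i : continuous (fun x : 'rV[R]_m.+1 => F' (x 0 i)).
  by move=> x; apply: (continuous_comp (ci x)); exact: cF'.
have cg : continuous (fun x : 'rV[R]_m.+1 => partial i v x * F (x 0 i) + v x * F' (x 0 i)).
  by move=> x; exact: (cvgD (cvgM (cv i x) (cFi x)) (cvgM (cv0 x) (cF'i x))).
rewrite (Rintegral_box_insert i a b cg); apply: eq_Rintegral => y _.
under eq_Rintegral do rewrite insert_coord_same.
pose G s := v (@insert_coord R m.+1 i s y) * F s.
pose G' s := partial i v (@insert_coord R m.+1 i s y) * F s + v (@insert_coord R m.+1 i s y) * F' s.
have cG' : continuous G'.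
  rewrite (_ : G' = (fun x => partial i v x * F (x 0 i) + v x * F' (x 0 i)) \o
      (fun s => @insert_coord R m.+1 i s y)).
    by move=> s; exact: (continuous_comp (@insert_coord_continuous m i y s) (cg _)).
  by apply/funext => s; rewrite /G' /= insert_coord_same.
have dG s : is_derive (s : R) (1 : R) G (G' s).
  have h1 := derive_insert_coord (dv (@insert_coord R m.+1 i s y)).
  have h2 := dF s.
  apply: (is_derive_eq (is_deriveM h1 h2)).
  by rewrite /G' /GRing.scale/=; ring.
have iG' : lebesgue_measure.-integrable `[a 0 i, b 0 i] (EFin \o G').
  by apply: continuous_compact_integrable; [exact: segment_compact|exact: continuous_subspaceT].
rewrite -/(G' _) (_ : \int[_]_(x in _) _ = \int[lebesgue_measure]_(s in `]a 0 i, b 0 i[) G' s)//.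
have cG s : {for s, continuous G}.
  by apply: differentiable_continuous; rewrite -derivable1_diffP; have [] := dG s.
have iG'oo : lebesgue_measure.-integrable `]a 0 i, b 0 i[ (EFin \o G').
  by apply: integrableS iG' => //; exact: subset_itv_oo_cc.
have iG'co : lebesgue_measure.-integrable `[a 0 i, b 0 i[ (EFin \o G').
  by apply: integrableS iG' => //; exact: subset_itv_co_cc.
rewrite (Rintegral_itv_obnd_cbnd iG'oo) (Rintegral_itv_bndo_bndc iG'co).
rewrite /Rintegral (@continuous_FTC2 _ G' G) //.
- exact: continuous_subspaceT.
- split => [s _|//|//]; first by have [] := dG s.
  + by apply: cvg_at_right_filter; exact: cG.
  + by apply: cvg_at_left_filter; exact: cG.
- by move=> s _; rewrite derive1E; have [_ ->] := dG s.
Qed.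

End box_theory.

(** * Cutoff functions and weak gradients *)

Section one_variable.
Context {R : realType}.
Implicit Types (f g : R -> R) (s : R).

Definition C1R f f' : Prop :=
  (forall s, is_derive (s : R) (1 : R) f (f' s)) /\ continuous f'.

Lemma C1R_continuous f f' : C1R f f' -> continuous f.
Proof.
move=> [df _] s; apply: differentiable_continuous; rewrite -derivable1_diffP.
by have [] := df s.
Qed.

Arguments C1R_continuous [f f'] _ _.

Lemma eq_C1R f f' g g' : f =1 g -> f' =1 g' -> C1R f f' -> C1R g g'.
Proof. by move=> /funext -> /funext ->. Qed.

Lemma C1R_cst (c : R) : C1R (fun=> c) (fun=> 0).
Proof. by split => s; [exact: is_derive_cst|exact: cvg_cst]. Qed.

Lemma C1R_id : C1R id (fun=> 1).
Proof. by split => s; [exact: is_derive_id|exact: cvg_cst]. Qed.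

Lemma C1R_D f f' g g' : C1R f f' -> C1R g g' ->
  C1R (fun s => f s + g s) (fun s => f' s + g' s).
Proof.
move=> [df cf] [dg cg]; split => s; first exact: is_deriveD.
by apply: cvgD; [exact: cf|exact: cg].
Qed.

Lemma C1R_M f f' g g' : C1R f f' -> C1R g g' ->
  C1R (fun s => f s * g s) (fun s => f' s * g s + f s * g' s).
Proof.
move=> Cf Cg; have [df cf] := Cf; have [dg cg] := Cg; split => s.
  apply: (is_derive_eq (is_deriveM (df s) (dg s))).
  by rewrite /GRing.scale/=; ring.
apply: cvgD; apply: cvgM.
- exact: cf.
- exact: C1R_continuous Cg s.
- exact: C1R_continuous Cf s.
- exact: cg.
Qed.

Lemma C1R_comp f f' g g' : C1R f f' -> C1R g g' ->
  C1R (fun s => f (g s)) (fun s => f' (g s) * g' s).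
Proof.
move=> [df cf] Cg; have [dg cg] := Cg; split => s.
  exact: (is_derive1_comp (df (g s)) (dg s)).
apply: cvgM; last exact: cg.
exact: (cvg_comp _ _ (C1R_continuous Cg s) (cf (g s))).
Qed.

Lemma C1R_V f f' : (forall s, f s != 0) -> C1R f f' ->
  C1R (fun s => (f s)^-1) (fun s => - (f s) ^- 2 * f' s).
Proof.
move=> f0 Cf; have [df cf] := Cf; split => s; first exact: is_deriveV.
apply: cvgM; last exact: cf.
apply: cvgN; apply: cvgV; first by rewrite expf_neq0.
by apply: cvgM; exact: C1R_continuous Cf s.
Qed.

Lemma C1R_cos : C1R cos (fun s => - sin s).
Proof.
split => s; first exact: is_derive_cos.
by apply: cvgN; exact: continuous_sin.
Qed.

Lemma C1R_sin : C1R sin cos.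
Proof. by split => s; [exact: is_derive_sin|exact: continuous_cos]. Qed.

Lemma C1R_affine (k c : R) : C1R (fun s => k * (s - c)) (fun=> k).
Proof.
apply: eq_C1R (C1R_M (C1R_cst k) (C1R_D C1R_id (C1R_cst (- c)))) => // s.
by ring.
Qed.

(** Meant for the square of the positive part, where the rules of differentiation fail at the kink 0
    of [Num.max]. *)
Lemma is_derive_quadratic_remainder f (t d C : R) :
  (forall h, `|f (h + t) - f t - h * d| <= C * h ^+ 2) ->
  is_derive (t : R) (1 : R) f d.
Proof.
move=> H.
have h : (fun h : R => h^-1 *: ((f \o shift t) (h *: 1) - f t)) @ 0^' --> d.
  apply/cvgrPdist_le => e e0; near=> h.
  have h0 : h != 0 by near: h; exact: nbhs_dnbhs_neq.
  have -> : d - h^-1 *: ((f \o shift t) (h *: 1) - f t) =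
    - (h^-1 * (f (h + t) - f t - h * d)).
    by rewrite /= /GRing.scale/= mulr1; field.
  rewrite normrN normrM normfV ler_pdivrMl ?normr_gt0//.
  apply: (le_trans (H h)); rewrite -real_normK ?num_real// expr2 mulrCA ler_wpM2l//.
  apply: (@le_trans _ _ (`|C| * `|h|)); first by rewrite ler_wpM2r// ler_norm.
  apply: (@le_trans _ _ ((`|C| + 1) * `|h|)); first by rewrite ler_wpM2r// lerDl.
  rewrite mulrC -ler_pdivlMr ?ltr_wpDl//.
  by near: h; apply: dnbhs0_le; rewrite divr_gt0// ltr_wpDl.
by apply: DeriveDef; [apply/cvg_ex; exists d|exact: cvg_lim].
Unshelve. all: by end_near. Qed.

Lemma maxr0_sqr_remainder (t h : R) :
  `|Num.max 0 (h + t) ^+ 2 - Num.max 0 t ^+ 2 - h * (2 * Num.max 0 t)| <= 1 * h ^+ 2.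
Proof.
rewrite mul1r ler_norml.
by case: (leP 0 (h + t)) => h1; case: (leP 0 t) => h2; apply/andP; split; nra.
Qed.

Lemma C1R_maxr0_sqr : C1R (fun t => Num.max 0 t ^+ 2) (fun t => 2 * Num.max 0 t).
Proof.
split => t.
  by apply: (@is_derive_quadratic_remainder _ _ _ 1); exact: maxr0_sqr_remainder.
apply: cvgM; first exact: cvg_cst.
by apply: continuous_max; [exact: cvg_cst|exact: cvg_id].
Qed.

Let y (a b s : R) := (s - a) * (b - s).
Let y' (a b s : R) := a + b - 2 * s.
Let p (e t : R) := Num.max 0 (t - e) ^+ 2.
Let p' (e t : R) := 2 * Num.max 0 (t - e).

(* Vanishes where (s-a)(b-s) <= e, and its derivative is O(1/((s-a)(b-s)))
   uniformly in e. *)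
Definition cutoff (a b e s : R) := p e (y a b s) / (p e (y a b s) + e ^+ 2).
Definition cutoff' (a b e s : R) :=
  p' e (y a b s) * y' a b s * e ^+ 2 / (p e (y a b s) + e ^+ 2) ^+ 2.

Let p_ge0 e t : 0 <= p e t. Proof. exact: sqr_ge0. Qed.

Let pD_gt0 e t : 0 < e -> 0 < p e t + e ^+ 2.
Proof. by move=> e0; rewrite ltr_wpDl// exprn_gt0. Qed.

Lemma C1R_cutoff a b e : 0 < e -> C1R (cutoff a b e) (cutoff' a b e).
Proof.
move=> e0.
have Cy : C1R (y a b) (y' a b).
  by apply: eq_C1R (C1R_M (C1R_affine 1 a) (C1R_affine (-1) b)) => s;
    rewrite /y /y'; ring.
have Cp : C1R (p e) (p' e).
  by apply: eq_C1R (C1R_comp C1R_maxr0_sqr (C1R_affine 1 e)) => s;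
    rewrite /p /p' mul1r ?mulr1.
have Cpy := C1R_comp Cp Cy.
have Cd := C1R_V (fun s => lt0r_neq0 (pD_gt0 (y a b s) e0)) (C1R_D Cpy (C1R_cst (e ^+ 2))).
apply: eq_C1R (C1R_M Cpy Cd) => // s.
rewrite /cutoff'; move: (lt0r_neq0 (pD_gt0 (y a b s) e0)).
by move: (p e _) (p' e _) (y' a b s) => u v w h; field.
Qed.

Lemma cutoff_le1 a b e s : 0 < e -> `|cutoff a b e s| <= 1.
Proof.
move=> e0; rewrite ger0_norm; last by rewrite divr_ge0// ltW// pD_gt0.
by rewrite ler_pdivrMr ?pD_gt0// mul1r lerDl sqr_ge0.
Qed.

Lemma cutoff_eq0 a b e s : 0 < e -> (s - a) * (b - s) <= e -> cutoff a b e s = 0.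
Proof.
move=> e0 ye; rewrite /cutoff /p.
by rewrite (max_idPl _) ?subr_le0// expr0n mul0r.
Qed.

(** The bound is uniform in e. Hence if h vanishes to first order at both ends, h times the
    derivative of the cutoff stays bounded as e tends to 0, and dominated convergence applies. *)
Lemma cutoff'_le a b e s : a < b -> 0 < e -> a < s < b ->
  `|cutoff' a b e s| * ((s - a) * (b - s)) <= 4 * (b - a).
Proof.
move=> ab e0 /andP[as_ sb].
have y0 : 0 < y a b s by rewrite /y mulr_gt0// subr_gt0.
rewrite -/(y a b s) /cutoff'.
rewrite normrM normfV [X in _ / X]ger0_norm ?sqr_ge0//.
rewrite mulrAC ler_pdivrMr; last by rewrite exprn_gt0// pD_gt0.
rewrite normrM [`|e ^+ 2|]ger0_norm ?sqr_ge0// normrM.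
have y'_le : `|y' a b s| <= b - a by rewrite /y' ler_norml; apply/andP; split; lra.
rewrite [`|p' _ _|]ger0_norm; last by rewrite /p' mulr_ge0// le_max lexx.
have P : p' e (y a b s) * e ^+ 2 * y a b s <= 4 * (p e (y a b s) + e ^+ 2) ^+ 2.
  rewrite /p' /p; case: (leP 0 (y a b s - e)) => h; last first.
    by rewrite mulr0 !mul0r mulr_ge0// sqr_ge0.
  move: (y a b s) h {y0} => t h.
  rewrite (_ : t = (t - e) + e); last by ring.
  move: (t - e) h => z z0; rewrite addrK.
  (* With z = t - e the claim is 2 z e^2 (z + e) <= 4 (z^2 + e^2)^2; the difference is displayed as
     a sum of squares with positive weights. *)
  rewrite -subr_ge0 (_ : _ - _ = e ^+ 2 * (z - e) ^+ 2 + 4 * (z ^+ 2) ^+ 2 +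
    5 * (z ^+ 2 * e ^+ 2) + 3 * (e ^+ 2) ^+ 2); last by ring.
  by repeat (first [exact: sqr_ge0|exact: ler0n|apply: addr_ge0|apply: mulr_ge0]).
have -> : p' e (y a b s) * `|y' a b s| * e ^+ 2 * y a b s =
   `|y' a b s| * (p' e (y a b s) * e ^+ 2 * y a b s) by ring.
have -> : 4 * (b - a) * (p e (y a b s) + e ^+ 2) ^+ 2 =
  (b - a) * (4 * (p e (y a b s) + e ^+ 2) ^+ 2) by ring.
apply: ler_pM => //; apply: mulr_ge0; last exact: ltW.
apply: mulr_ge0; last exact: sqr_ge0.
by rewrite /p' mulr_ge0// le_max lexx.
Qed.

Let p_cvg t : 0 < t -> p (harmonic k) t @[k --> \oo] --> t ^+ 2.
Proof.
move=> t0; rewrite /p -{2}(_ : Num.max 0 (t - 0) = t); last first.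
  by rewrite subr0 (max_idPr _)// ltW.
have h : t - harmonic k @[k --> \oo] --> t - 0.
  by apply: cvgB; [exact: cvg_cst|exact: cvg_harmonic].
exact: (cvg_comp _ _ h (C1R_continuous C1R_maxr0_sqr _)).
Qed.

Let e2_cvg : (harmonic k) ^+ 2 @[k --> \oo] --> (0 : R).
Proof. by rewrite -[X in _ --> X](mul0r 0); apply: cvgM; exact: cvg_harmonic. Qed.

Lemma cvg_cutoff a b s : a < s < b ->
  cutoff a b (harmonic k) s @[k --> \oo] --> (1 : R).
Proof.
move=> /andP[as_ sb].
have y0 : 0 < y a b s by rewrite /y mulr_gt0// subr_gt0.
rewrite -[X in _ --> X](_ : y a b s ^+ 2 / (y a b s ^+ 2 + 0) = _); last first.
  by rewrite addr0 divff// expf_neq0// gt_eqF.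
apply: cvgM; first exact: p_cvg.
apply: cvgV; first by rewrite addr0 expf_neq0// gt_eqF.
by apply: cvgD; [exact: p_cvg|exact: e2_cvg].
Qed.

Lemma cvg_cutoff' a b s : a < s < b ->
  cutoff' a b (harmonic k) s @[k --> \oo] --> (0 : R).
Proof.
move=> /andP[as_ sb].
have y0 : 0 < y a b s by rewrite /y mulr_gt0// subr_gt0.
rewrite -[X in _ --> X](_ : 2 * y a b s * y' a b s * 0 / (y a b s ^+ 2 + 0) ^+ 2 = _); last first.
  by rewrite mulr0 mul0r.
apply: cvgM; last first.
  apply: cvgV; first by rewrite addr0 expf_neq0// expf_neq0// gt_eqF.
  by apply: cvgM; apply: cvgD; first [exact: p_cvg|exact: e2_cvg].
apply: cvgM; last exact: e2_cvg.
apply: cvgM; last exact: cvg_cst.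
apply: cvgM; first exact: cvg_cst.
rewrite -[X in _ --> X](_ : Num.max 0 (y a b s - 0) = _); last first.
  by rewrite subr0 (max_idPr _)// ltW.
have h : y a b s - harmonic k @[k --> \oo] --> y a b s - 0.
  by apply: cvgB; [exact: cvg_cst|exact: cvg_harmonic].
have cm : {for y a b s - 0, continuous (fun z : R => Num.max 0 z)}.
  by apply: continuous_max; [exact: cvg_cst|exact: cvg_id].
exact: (cvg_comp _ _ h cm).
Qed.

End one_variable.

(** * C^1 functions of several variables and products of one-variable factors *)

Section C1_theory.
Context {R : realType} (n : nat).
Implicit Types (v w : 'rV[R]_n -> R) (h : 'I_n -> R -> R).

Lemma C1_continuous v : C1 v -> continuous v.
Proof. by move=> [dv _] x; exact: differentiable_continuous. Qed.
Arguments C1_continuous [v] _ _.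

Lemma eq_C1 v w : v =1 w -> C1 v -> C1 w.
Proof. by move=> /funext ->. Qed.

Lemma partial_cst i c : partial i (fun _ : 'rV[R]_n => c) = fun=> 0.
Proof. by apply/funext => x; exact: derive_cst. Qed.

Lemma C1_cst c : C1 (fun _ : 'rV[R]_n => c).
Proof.
split => [x|i]; first exact: differentiable_cst.
by rewrite partial_cst => x; exact: cst_continuous.
Qed.

Lemma partialD i v w : C1 v -> C1 w ->
  partial i (fun x => v x + w x) = fun x => partial i v x + partial i w x.
Proof.
move=> [dv _] [dw _]; apply/funext => x.
by apply: (@deriveD _ _ _ v w); exact: diff_derivable.
Qed.

Lemma C1_D v w : C1 v -> C1 w -> C1 (fun x => v x + w x).
Proof.
move=> Cv Cw; have [dv cv] := Cv; have [dw cw] := Cw; split => [x|i].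
  exact: differentiableD.
rewrite partialD// => x.
exact: (cvgD (cv i x) (cw i x)).
Qed.

Lemma partialM i v w : C1 v -> C1 w ->
  partial i (fun x => v x * w x) = fun x => v x * partial i w x + w x * partial i v x.
Proof.
move=> [dv _] [dw _]; apply/funext => x.
by apply: (@deriveM _ _ v w); exact: diff_derivable.
Qed.

Lemma C1_M v w : C1 v -> C1 w -> C1 (fun x => v x * w x).
Proof.
move=> Cv Cw; have [dv cv] := Cv; have [dw cw] := Cw; split => [x|i].
  exact: differentiableM.
rewrite partialM// => x.
exact: (cvgD (cvgM (C1_continuous Cv x) (cw i x)) (cvgM (C1_continuous Cw x) (cv i x))).
Qed.

Lemma C1_sum (I : Type) (r : seq I) (F : I -> 'rV[R]_n -> R) :
  (forall j, C1 (F j)) -> C1 (fun x => \sum_(j <- r) F j x).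
Proof.
move=> CF; elim: r => [|j r IH].
  by apply: eq_C1 (C1_cst 0) => x; rewrite big_nil.
by apply: eq_C1 (C1_D (CF j) IH) => x; rewrite big_cons.
Qed.

Lemma partial_sum i (I : Type) (r : seq I) (F : I -> 'rV[R]_n -> R) :
  (forall j, C1 (F j)) ->
  partial i (fun x => \sum_(j <- r) F j x) = fun x => \sum_(j <- r) partial i (F j) x.
Proof.
move=> CF; elim: r => [|j r IH].
  under eq_fun do rewrite big_nil; rewrite partial_cst.
  by apply/funext => x; rewrite big_nil.
under eq_fun do rewrite big_cons; rewrite partialD//; last exact: C1_sum.
by rewrite IH; apply/funext => x; rewrite big_cons.
Qed.

Lemma C1_prod (I : Type) (r : seq I) (P : pred I) (F : I -> 'rV[R]_n -> R) :
  (forall j, C1 (F j)) -> C1 (fun x => \prod_(j <- r | P j) F j x).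
Proof.
move=> CF; elim: r => [|j r IH].
  by apply: eq_C1 (C1_cst 1) => x; rewrite big_nil.
have [Pj|Pj] := boolP (P j).
  by apply: eq_C1 (C1_M (CF j) IH) => x; rewrite big_cons Pj.
by apply: eq_C1 IH => x; rewrite big_cons (negbTE Pj).
Qed.

Lemma partial_prod_eq0 i (I : Type) (r : seq I) (P : pred I) (F : I -> 'rV[R]_n -> R) :
  (forall j, C1 (F j)) -> (forall j, P j -> partial i (F j) = fun=> 0) ->
  partial i (fun x => \prod_(j <- r | P j) F j x) = fun=> 0.
Proof.
move=> CF F0; elim: r => [|j r IH].
  by under eq_fun do rewrite big_nil; rewrite partial_cst.
have [Pj|Pj] := boolP (P j).
  under eq_fun do rewrite big_cons Pj; rewrite partialM//; last exact: C1_prod.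
  by apply/funext => x; rewrite IH F0// !mulr0 addr0.
by under eq_fun do rewrite big_cons (negbTE Pj).
Qed.

Lemma is_derive_coord i j (f : R -> R) d (x : 'rV[R]_n) :
  is_derive (x 0 j : R) (1 : R) f d ->
  partial i (fun x => f (x 0 j)) x = d *+ (i == j).
Proof.
move=> [df dfd]; rewrite /partial /derive.
have [->|ij] := eqVneq i j.
  rewrite mulr1n -dfd /derive (_ : (fun t => _) =
    (fun t : R => t^-1 *: ((f \o shift (x 0 j)) (t *: 1) - f (x 0 j))))//.
  by apply/funext => t /=; rewrite !mxE !eqxx /GRing.scale/= mulr1.
apply: cvg_lim => //.
rewrite (_ : (fun t => _) = fun=> 0); first exact: cvg_cst.
apply/funext => t /=; rewrite !mxE eqxx/= eq_sym (negbTE ij) mulr0 add0r.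
by rewrite subrr scaler0.
Qed.

Lemma partial_coord i j f f' : C1R f f' ->
  partial i (fun x : 'rV[R]_n => f (x 0 j)) = fun x => f' (x 0 j) *+ (i == j).
Proof. by move=> [df _]; apply/funext => x; exact: is_derive_coord. Qed.

Lemma C1_coord j f f' : C1R f f' -> C1 (fun x : 'rV[R]_n => f (x 0 j)).
Proof.
move=> Cf; split => [x|i].
  apply: (@differentiable_comp _ _ _ _ (fun x : 'rV[R]_n => x 0 j) f).
    exact: differentiable_coord.
  by apply/derivable1_diffP; have [] := Cf.1 (x 0 j).
rewrite (partial_coord _ _ Cf) => x.
case: (i == j) => /=; last exact: cst_continuous.
exact: (cvg_comp _ _ (@coord_continuous _ _ _ 0 j x) (Cf.2 (x 0 j))).
Qed.

Definition upd h i (g : R -> R) : 'I_n -> R -> R := fun j => if j == i then g else h j.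

Definition prodf h (x : 'rV[R]_n) : R := \prod_(j < n) h j (x 0 j).

Lemma prodfD1 h i x : prodf h x = h i (x 0 i) * \prod_(j < n | j != i) h j (x 0 j).
Proof. by rewrite /prodf (bigD1 i). Qed.

Lemma prodf_updE h i g x :
  prodf (upd h i g) x = g (x 0 i) * \prod_(j < n | j != i) h j (x 0 j).
Proof.
rewrite (prodfD1 _ i) /upd eqxx; congr (_ * _).
by apply: eq_bigr => j /negbTE ->.
Qed.

Lemma C1_prodf h h' : (forall j, C1R (h j) (h' j)) -> C1 (prodf h).
Proof. by move=> Ch; apply: C1_prod => j; exact: C1_coord (Ch j). Qed.

Lemma partial_prodf i h h' : (forall j, C1R (h j) (h' j)) ->
  partial i (prodf h) = prodf (upd h i (h' i)).
Proof.
move=> Ch; rewrite (_ : prodf h =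
  fun x => h i (x 0 i) * \prod_(j < n | j != i) h j (x 0 j)); last first.
  by apply/funext => x; exact: prodfD1.
have CF j : C1 (fun x : 'rV[R]_n => h j (x 0 j)) by exact: C1_coord (Ch j).
rewrite (partialM _ (CF i)); last exact: C1_prod.
rewrite partial_prod_eq0//; last first.
  by move=> j ji; rewrite (partial_coord _ _ (Ch j)) eq_sym (negbTE ji).
apply/funext => x; rewrite prodf_updE (partial_coord _ _ (Ch i)) eqxx mulr1n.
by rewrite mulr0 add0r mulrC.
Qed.

Lemma measurable_prodf h : (forall j, measurable_fun setT (h j)) ->
  measurable_fun setT (prodf h).
Proof.
move=> mh; apply: measurable_prod => j _.
exact: (measurableT_comp (mh j) (measurable_coord j)).
Qed.

Lemma prodf_bounded (a b : 'rV[R]_n) h (C : 'I_n -> R) x :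
  (forall j s, a 0 j < s < b 0 j -> `|h j s| <= C j) -> box a b x ->
  `|prodf h x| <= \prod_j C j.
Proof.
move=> hC xab; rewrite normr_prod; apply: ler_prod => j _.
by rewrite normr_ge0/= hC.
Qed.

Lemma prodf_convergence (a b : 'rV[R]_n) (f : 'rV[R]_n -> R)
    (g_ : nat -> 'I_n -> R -> R) (g : 'I_n -> R -> R) (C : 'I_n -> R) :
  (leb n).-integrable (box a b) (EFin \o f) ->
  (forall k j, measurable_fun setT (g_ k j)) ->
  (forall k j s, a 0 j < s < b 0 j -> `|g_ k j s| <= C j) ->
  (forall j s, a 0 j < s < b 0 j -> g_ k j s @[k --> \oo] --> g j s) ->
  (\int[leb n]_(x in box a b) (f x * prodf (g_ k) x)) @[k --> \oo] -->
   \int[leb n]_(x in box a b) (f x * prodf g x).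
Proof.
move=> fi mg gC gg.
apply: (bounded_convergence (measurable_box a b) (C := \prod_j C j) fi).
- by move=> k; apply: measurable_funTS; exact: measurable_prodf.
- by move=> k x xab; exact: prodf_bounded (gC k) xab.
- move=> x xab; apply: cvg_big => [|j _]; first exact: mul_continuous.
  by apply: gg; exact: xab.
Qed.

End C1_theory.
Arguments C1_continuous [R n v] _ _.

(** * Weak gradients tested with products that do not have compact support *)

Section weak_gradients.
Context {R : realType} (n : nat) (a b : 'rV[R]_n).
Hypothesis ab : forall i, a 0 i < b 0 i.
Implicit Types (u v w : 'rV[R]_n -> R) (h : 'I_n -> R -> R).

Let mbox : measurable (box a b) := measurable_box a b.
Let boxoo : (leb n (box a b) < +oo)%E := leb_box_lty a b.

Lemma C1_L2 v : C1 v -> L2 a b v.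
Proof. by move=> Cv; apply: continuous_sqi_box; exact: C1_continuous. Qed.

Lemma C1_partial_L2 i v : C1 v -> L2 a b (partial i v).
Proof. by move=> [_ cv]; exact: continuous_sqi_box. Qed.

Lemma weak_gradient_C1 v : C1 v -> weak_gradient a b v (fun i => partial i v).
Proof.
move=> Cv i; split; first exact: C1_partial_L2.
move=> phi [Cphi [K [_ Kbox phi0]]].
have bdy0 x : ~ box a b x -> phi x = 0 by move=> xab; apply: phi0 => /Kbox.
have : \int[leb n]_(x in box a b)
    (partial i (fun x => v x * phi x) x * 1 + v x * phi x * 0) = 0.
  (* [green] is stated in dimension m.+1; in dimension 0 there is no index i. *)
  move: i; case: n a b ab v phi Cv Cphi bdy0 {K Kbox phi0} => [|m] a' b' ab' v' phi' Cv Cphi bdy0 i.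
    by case: i.
  rewrite (green (ab' i) (C1_M Cv Cphi) (C1R_cst 1).1 (C1R_cst 1).2).
  rewrite (_ : \int[_]_(y in _) _ = \int[leb m]_(y in face a' b' i) 0).
    by rewrite Rintegral_cst ?mul0r//; exact: measurable_box.
  apply: eq_Rintegral => y _; rewrite !bdy0 ?mulr0 ?mul0r ?subr0//.
  - by move=> /box_insert_coord[/andP[h1 h2] _]; move: h1 h2; rewrite ltxx.
  - by move=> /box_insert_coord[/andP[h1 h2] _]; move: h1 h2; rewrite ltxx.
rewrite partialM// (_ : \int[_]_(x in _) _ =
  \int[leb n]_(x in box a b) (v x * partial i phi x + partial i v x * phi x)); last first.
  by apply: eq_Rintegral => x _; ring.
rewrite RintegralD//; last 2 first.
- exact: (sqi_mul mbox (C1_L2 Cv) (C1_partial_L2 i Cphi)).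
- exact: (sqi_mul mbox (C1_partial_L2 i Cv) (C1_L2 Cphi)).
by move/eqP; rewrite addr_eq0 => /eqP.
Qed.

Section cutoff_products.
Variables (h h' : 'I_n -> R -> R).
Hypothesis Ch : forall j, C1R (h j) (h' j).

Let chi k j := cutoff (a 0 j) (b 0 j) (harmonic k).
Let chi' k j := cutoff' (a 0 j) (b 0 j) (harmonic k).
Let hk k j s := h j s * chi k j s.
Let hk' k j s := h' j s * chi k j s + h j s * chi' k j s.

Let harm0 k : 0 < harmonic k :> R.
Proof. by rewrite /harmonic /= invr_gt0. Qed.

Let C1R_hk k j : C1R (hk k j) (hk' k j).
Proof. exact: C1R_M (Ch j) (C1R_cutoff _ _ (harm0 k)). Qed.

Let compact_support_hk k : C1_compact_support (box a b) (prodf (hk k)).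
Proof.
split; first exact: C1_prodf (C1R_hk k).
(* The cutoff vanishes where (s - a)(b - s) <= [harmonic k]. What remains is closed in the segment
   and misses both endpoints, since the product is positive there; the product of these compact sets
   contains the support. *)
pose A j : set R := `[a 0 j, b 0 j]%classic `&`
  [set s | harmonic k <= (s - a 0 j) * (b 0 j - s)].
exists [set x : 'rV[R]_n | forall j, A j (x ord0 j)]; split.
- apply: (rV_compact (A := A)) => j.
  apply: (@subclosed_compact _ _ `[a 0 j, b 0 j]%classic).
  + apply: closedI; first exact: itv_closed.
    apply: (@preimage_closed _ _ (fun s => (s - a 0 j) * (b 0 j - s)) [set t | harmonic k <= t]).
      move=> s _; apply: cvgM; apply: cvgB; try exact: cvg_cst; exact: cvg_id.
    exact: closed_ge.
  + exact: segment_compact.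
  + by move=> s [].
- move=> x Ax j; have [/=] := Ax j; rewrite in_itv/= => /andP[h1 h2] h3.
  have : 0 < (x 0 j - a 0 j) * (b 0 j - x 0 j) by exact: lt_le_trans h3.
  move=> h4; rewrite !lt_neqAle h1 h2 !andbT.
  by apply/andP; split; apply: contraTneq h4 => ->; rewrite subrr ?mul0r ?mulr0 ltxx.
- move=> x Ax; suff [j hj] : exists j, hk k j (x 0 j) = 0.
    by rewrite (prodfD1 _ j) hj mul0r.
  have /existsNP[j Aj] := Ax; exists j.
  rewrite /hk; have [yk|yk] := leP ((x 0 j - a 0 j) * (b 0 j - x 0 j)) (harmonic k).
    by rewrite /chi cutoff_eq0// mulr0.
  exfalso; apply: Aj; split => /=; last exact: ltW.
  have y0 := lt_trans (harm0 k) yk.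
  rewrite in_itv/=; apply/andP; split; rewrite leNgt; apply/negP => xj;
    move: y0; apply/negP; rewrite -leNgt.
  + rewrite mulr_le0_ge0// ?subr_le0 ?subr_ge0 ltW//.
    exact: lt_trans xj (ab j).
  + rewrite mulr_ge0_le0// ?subr_le0 ?subr_ge0 ltW//.
    exact: lt_trans (ab j) xj.
Qed.

Lemma continuous_bounded_itv (f : R -> R) (s t : R) : continuous f ->
  exists M, forall r, s < r < t -> `|f r| <= M.
Proof.
move=> cf.
have : compact (f @` `[s, t]%classic).
  by apply: continuous_compact; [exact: continuous_subspaceT|exact: segment_compact].
move/compact_bounded => [M [_ MK]]; exists (M + 1) => r /andP[sr rt].
apply: (MK (M + 1)); first by rewrite ltrDl.
by exists r => //; rewrite /= in_itv/= !ltW.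
Qed.

Let hC : exists C : 'I_n -> R, forall j s, a 0 j < s < b 0 j -> `|h j s| <= C j.
Proof.
have /choice[C CP] : forall j, exists M, forall s, a 0 j < s < b 0 j -> `|h j s| <= M.
  by move=> j; apply: continuous_bounded_itv; exact: C1R_continuous (Ch j).
by exists C.
Qed.

Let hk_le k j s : `|hk k j s| <= `|h j s|.
Proof. by rewrite /hk normrM ler_piMr//; exact: cutoff_le1. Qed.

Let hk_cvg j s : a 0 j < s < b 0 j -> hk k j s @[k --> \oo] --> h j s.
Proof.
move=> sab; rewrite -[X in _ --> X]mulr1.
by apply: cvgM; [exact: cvg_cst|exact: cvg_cutoff].
Qed.

Let mhk k j : measurable_fun setT (hk k j).
Proof.
by apply: continuous_measurable_fun; exact: C1R_continuous (C1R_hk k j).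
Qed.

Let hk_convergence f : (leb n).-integrable (box a b) (EFin \o f) ->
  (\int[leb n]_(x in box a b) (f x * prodf (hk k) x)) @[k --> \oo] -->
   \int[leb n]_(x in box a b) (f x * prodf h x).
Proof.
move=> fi; have [C CP] := hC.
apply: (prodf_convergence (C := C) fi) => //.
by move=> k j s sab; exact: le_trans (hk_le k j s) (CP _ _ sab).
Qed.

(** No derivative falls on the cutoff here, so the factors h need no boundary condition. *)
Lemma Rintegral_prodf_eq0 f : (leb n).-integrable (box a b) (EFin \o f) ->
  (forall phi, C1_compact_support (box a b) phi ->
     \int[leb n]_(x in box a b) (f x * phi x) = 0) ->
  \int[leb n]_(x in box a b) (f x * prodf h x) = 0.
Proof.
move=> fi f0; apply/esym; apply: (cvg_unique _ _ (hk_convergence fi)) => //.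
rewrite (_ : (fun k => _) = fun=> 0); first exact: cvg_cst.
by apply/funext => k; exact: f0 (compact_support_hk k).
Qed.

(** Differentiation in direction i hits only the i-th cutoff, so only the factor [h i] has to vanish
    at the ends of its interval. *)
Lemma weak_integration_by_parts u G i (C : R) : L2 a b u ->
  weak_gradient a b u G -> 0 <= C ->
  (forall s, a 0 i < s < b 0 i -> `|h i s| <= C * ((s - a 0 i) * (b 0 i - s))) ->
  \int[leb n]_(x in box a b) (u x * partial i (prodf h) x) =
  - \int[leb n]_(x in box a b) (G i x * prodf h x).
Proof.
move=> u2 uG C0 hi; have [Gi2 Gi] := uG i.
have ui := sqi_ig mbox boxoo u2; have Gii := sqi_ig mbox boxoo Gi2.
have lim1 := hk_convergence Gii.
have [D DP] := hC.
have [D' DP'] := continuous_bounded_itv (a 0 i) (b 0 i) (Ch i).2.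
have lim2 : (\int[leb n]_(x in box a b) (u x * partial i (prodf (hk k)) x)) @[k --> \oo] -->
   \int[leb n]_(x in box a b) (u x * partial i (prodf h) x).
  rewrite (partial_prodf _ Ch).
  under eq_fun do rewrite (partial_prodf _ (C1R_hk _)).
  (* For the i-th factor h' chi + h chi', D' bounds the first term; the hypothesis on [h i] together
     with [cutoff'_le] bounds the second by 4 C (b - a). *)
  apply: (prodf_convergence (C := fun j => if j == i then D' + C * (4 * (b 0 i - a 0 i)) else D j) ui).
  - move=> k j; rewrite /upd; case: eqP => _; last exact: mhk.
    by apply: continuous_measurable_fun; exact: (C1R_hk k i).2.
  - move=> k j s; rewrite /upd; case: eqP => [->|_] sab; last first.
      exact: le_trans (hk_le k j s) (DP _ _ sab).
    apply: le_trans (ler_normD _ _) _; apply: lerD.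
      rewrite normrM; apply: le_trans (DP' _ sab).
      by rewrite ler_piMr//; exact: cutoff_le1.
    rewrite normrM.
    apply: (@le_trans _ _ (C * ((s - a 0 i) * (b 0 i - s)) * `|chi' k i s|)).
      by rewrite ler_wpM2r// hi.
    by rewrite -mulrA ler_wpM2l// mulrC; exact: cutoff'_le.
  - move=> j s; rewrite /upd; case: eqP => [->|_] sab; last exact: hk_cvg.
    rewrite -[X in _ --> X](_ : h' i s * 1 + h i s * 0 = _); last by rewrite mulr1 mulr0 addr0.
    apply: cvgD; apply: cvgM; try exact: cvg_cst; first exact: cvg_cutoff.
    exact: cvg_cutoff'.
apply: (cvg_unique _ lim2) => //.
rewrite (_ : (fun k => _) = fun k => - \int[leb n]_(x in box a b) (G i x * prodf (hk k) x)).
  exact: cvgN lim1.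
by apply/funext => k; exact: Gi (compact_support_hk k).
Qed.

End cutoff_products.
End weak_gradients.

(** * Totality of the products of cosines *)

Section threshold_powers.
Context {R : realType}.
Implicit Types (q t r x : R) (k : nat).

(** 1 - r^(k+1) is (1 - r) times the geometric sum 1 + ... + r^k, whose k + 1 terms are all at least
    r^k. *)
Lemma mulrn_expr_le r k : 0 <= r <= 1 -> k.+1%:R * r ^+ k * (1 - r) + r ^+ k.+1 <= 1.
Proof.
move=> /andP[r0 r1]; elim: k => [|k IH].
  by rewrite expr0 expr1 !mul1r subrK.
have -> : k.+2%:R * r ^+ k.+1 * (1 - r) + r ^+ k.+2 =
    r * (k.+1%:R * r ^+ k * (1 - r) + r ^+ k.+1) + r ^+ k.+1 * (1 - r).
  by rewrite -[k.+2%:R]natr1 !exprS; ring.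
have h1 : r * (k.+1%:R * r ^+ k * (1 - r) + r ^+ k.+1) <= r by rewrite ler_piMr.
have h2 : r ^+ k.+1 * (1 - r) <= 1 - r.
  by rewrite ler_piMl ?subr_ge0// exprn_ile1.
by rewrite (le_trans (lerD h1 h2))// addrC subrK.
Qed.

(** With s the square root of r, one factor s^k absorbs k + 1 at the cost of 1 / (1 - s), and the
    other tends to 0. *)
Lemma cvg_mulrn_expr r : 0 <= r < 1 -> k.+1%:R * r ^+ k @[k --> \oo] --> (0 : R).
Proof.
move=> /andP[r0 r1]; pose s := Num.sqrt r.
have s0 : 0 <= s by exact: sqrtr_ge0.
have rE : r = s ^+ 2 by rewrite sqr_sqrtr.
have s1 : s < 1 by rewrite -sqrtr1 ltr_sqrt.
have h : (1 - s)^-1 * s ^+ k @[k --> \oo] --> (0 : R).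
  rewrite -[X in _ --> X](mulr0 (1 - s)^-1); apply: cvgM; first exact: cvg_cst.
  by apply: cvg_expr; rewrite ger0_norm.
apply: (squeeze_cvgr _ (cvg_cst 0) h); apply: nearW => k.
rewrite mulr_ge0 ?exprn_ge0//= rE exprAC expr2 mulrA ler_wpM2r ?exprn_ge0//.
rewrite -[leRHS]mul1r ler_pdivlMr ?subr_gt0//.
apply: le_trans (@mulrn_expr_le s k _); last by rewrite s0 ltW.
by rewrite lerDl exprn_ge0.
Qed.

Lemma bernoulli_le x k : 0 <= x <= 1 -> 1 - k%:R * x <= (1 - x) ^+ k.
Proof.
move=> /andP[x0 x1]; elim: k => [|k IH]; first by rewrite mul0r subr0 expr0.
rewrite exprS; apply: (@le_trans _ _ ((1 - x) * (1 - k%:R * x))).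
  rewrite -subr_ge0 (_ : _ - _ = k%:R * x ^+ 2) ?mulr_ge0 ?sqr_ge0//.
  by rewrite -[k.+1]addn1 natrD; ring.
by rewrite ler_wpM2l// subr_ge0.
Qed.

Lemma bernoulli_ge x k : 0 <= x -> 1 + k%:R * x <= (1 + x) ^+ k.
Proof.
move=> x0; elim: k => [|k IH]; first by rewrite mul0r addr0 expr0.
rewrite exprS; apply: (@le_trans _ _ ((1 + x) * (1 + k%:R * x))).
  rewrite -subr_ge0 (_ : _ - _ = k%:R * x ^+ 2) ?mulr_ge0 ?sqr_ge0//.
  by rewrite -[k.+1]addn1 natrD; ring.
by rewrite ler_wpM2l// addr_ge0.
Qed.

(** An integer M just above k / t^k: for 0 < t < 1 and q in [0, 1], M q^k tends to 0 when q < t and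
    is at least k when q >= t. Since (1 - q^k)^M behaves like exp(- M q^k), this separates the two
    cases. *)
Definition threshold_exponent t k : nat := (Num.truncn (k%:R * t ^- k)).+1.

(* The classical polynomial approximation of the indicator function of q < t
   on [0, 1]. *)
Definition threshold t k q : R := (1 - q ^+ k) ^+ threshold_exponent t k.

Lemma continuous_threshold t k : continuous (threshold t k).
Proof.
rewrite (_ : threshold t k = horner ((1 - 'X^k) ^+ threshold_exponent t k)).
  exact: continuous_horner.
by apply/funext => q; rewrite !(hornerE, horner_exp).
Qed.

Lemma threshold_bounded t k q : 0 <= q <= 1 -> `|threshold t k q| <= 1.
Proof.
move=> /andP[q0 q1].
have h : 0 <= 1 - q ^+ k <= 1.
  by rewrite subr_ge0 exprn_ile1//= gerBl exprn_ge0.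
rewrite ger0_norm; last by apply: exprn_ge0; case/andP: h.
by case/andP: h => h1 h2; exact: exprn_ile1.
Qed.

Lemma cvg_threshold t q : 0 < t < 1 -> 0 <= q <= 1 ->
  (fun k : nat => threshold t k q) @ \oo --> (if q < t then 1 else 0 : R).
Proof.
move=> /andP[t0 t1] /andP[q0 q1].
have qk k : 0 <= q ^+ k <= 1 by rewrite exprn_ge0//= exprn_ile1.
have p0 k : 0 <= threshold t k q.
  by apply: exprn_ge0; rewrite subr_ge0; case/andP: (qk k).
have [qt|tq] /= := ltP q t.
  have r01 : 0 <= q / t < 1 by rewrite divr_ge0 ?(ltW t0)//= ltr_pdivrMr// mul1r.
  have h : 1 - k.+1%:R * (q / t) ^+ k @[k --> \oo] --> (1 : R).
    rewrite -[X in _ --> X]subr0; apply: cvgB; first exact: cvg_cst.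
    exact: cvg_mulrn_expr.
  have h1 : (fun _ : nat => 1 : R) @ \oo --> (1 : R) by exact: cvg_cst.
  apply: (squeeze_cvgr _ h h1); apply: nearW => k.
  apply/andP; split; last first.
    by have := threshold_bounded t k (introT andP (conj q0 q1)); rewrite ger0_norm.
  apply: le_trans (bernoulli_le _ (qk k)); rewrite lerD2l lerN2.
  rewrite exprMn exprVn.
  rewrite [leRHS](_ : _ = k.+1%:R * t ^- k * q ^+ k); last by ring.
  rewrite ler_wpM2r//; first by case/andP: (qk k).
  have tk : 1 <= t ^- k by rewrite invf_ge1 ?exprn_gt0// exprn_ile1// ltW.
  rewrite /threshold_exponent -!natr1 mulrDl mul1r lerD//.
  by rewrite truncn_le mulr_ge0// (le_trans _ tk).
have h : @harmonic R k @[k --> \oo] --> (0 : R) by exact: cvg_harmonic.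
apply: (squeeze_cvgr _ (cvg_cst 0) h); apply: nearW => k; rewrite p0/=.
set M := threshold_exponent t k.
have tk0 : 0 < t ^+ k by exact: exprn_gt0.
have Mt : k%:R <= M%:R * q ^+ k.
  apply: (@le_trans _ _ (M%:R * t ^+ k)); last first.
    by rewrite ler_wpM2l// lerXn2r ?nnegrE// ltW.
  by rewrite -ler_pdivrMr// ltW// truncnS_gt.
rewrite /harmonic /= -[leRHS]mul1r ler_pdivlMr//.
(* The product is (1 - q^(2k))^M, and (1 + q^k)^M >= 1 + M q^k >= k + 1 by Bernoulli, so the
   threshold polynomial is at most 1 / (k + 1). *)
have e1 : (1 - q ^+ k) ^+ M * (1 + q ^+ k) ^+ M <= 1.
  rewrite -exprMn exprn_ile1//.
    by rewrite mulr_ge0// ?subr_ge0 ?addr_ge0//; case/andP: (qk k).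
  by rewrite -subr_sqr expr1n gerBl sqr_ge0.
apply: le_trans e1; rewrite ler_wpM2l//.
apply: le_trans (bernoulli_ge _ _); last by case/andP: (qk k).
by rewrite -[k.+1]add1n natrD lerD2l.
Qed.

End threshold_powers.

Section totality.
Context {R : realType} (n : nat) (a b : 'rV[R]_n).
Hypothesis ab : forall i, a 0 i < b 0 i.
Variable f : 'rV[R]_n -> R.
Hypothesis fi : (leb n).-integrable (box a b) (EFin \o f).

Let mbox : measurable (box a b) := measurable_box a b.
Let boxoo : (leb n (box a b) < +oo)%E := leb_box_lty a b.

(* Eigenfunctions of the one-dimensional Neumann problem in coordinate j. *)
Definition cosn (k : nat) (j : 'I_n) (s : R) : R :=
  cos (k%:R * (pi / (b 0 j - a 0 j)) * (s - a 0 j)).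

Lemma continuous_cosn k j : continuous (cosn k j).
Proof. exact: C1R_continuous (C1R_comp C1R_cos (C1R_affine _ _)). Qed.

Lemma cosn0 j s : cosn 0 j s = 1.
Proof. by rewrite /cosn !mul0r cos0. Qed.

(** Multiplication by the first cosine keeps the span of the cosines invariant, so a functional that
    kills every cosine also kills every polynomial in the first one. *)
Lemma cosn1_mul k j s :
  cosn 1 j s * cosn k.+1 j s = 2^-1 * cosn k.+2 j s + 2^-1 * cosn k j s.
Proof.
rewrite /cosn mul1r; set t := pi / _ * _.
have E m : m%:R * (pi / (b 0 j - a 0 j)) * (s - a 0 j) = m%:R * t by rewrite -mulrA.
rewrite !E.
have -> : k.+2%:R * t = k.+1%:R * t + t by rewrite -[k.+2%:R]natr1 mulrDl mul1r.
have -> : k%:R * t = k.+1%:R * t - t by rewrite -[k.+1%:R]natr1 mulrDl mul1r addrK.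
by rewrite cosD cosB; field.
Qed.

Section one_coordinate.
Variables (h : 'I_n -> R -> R) (C : 'I_n -> R) (i : 'I_n).
Hypothesis mh : forall j, measurable_fun setT (h j).
Hypothesis hC : forall j s, `|h j s| <= C j.

Let T (g : R -> R) := \int[leb n]_(x in box a b) (f x * prodf (upd h i g) x).

Let bdd (g : R -> R) := measurable_fun setT g /\
  exists M, forall s, a 0 i < s < b 0 i -> `|g s| <= M.

Let bdd_continuous g : continuous g -> bdd g.
Proof.
move=> cg; split; first exact: continuous_measurable_fun.
exact: continuous_bounded_itv.
Qed.

Let ig_bdd g : bdd g ->
  (leb n).-integrable (box a b) (EFin \o (fun x => f x * prodf (upd h i g) x)).
Proof.
move=> [mg [M gM]].
apply: (ig_mulbounded mbox (C := \prod_j (if j == i then M else C j)) fi).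
  apply: measurable_funTS; apply: measurable_prodf => j.
  by rewrite /upd; case: eqP.
move=> x xab; apply: (prodf_bounded _ xab) => j s sab.
by rewrite /upd; case: eqP => [ji|_]; [apply: gM; rewrite -ji|exact: hC].
Qed.

Let TD g1 g2 : bdd g1 -> bdd g2 -> T (fun s => g1 s + g2 s) = T g1 + T g2.
Proof.
move=> b1 b2; rewrite /T -RintegralD//; [|exact: ig_bdd|exact: ig_bdd].
by apply: eq_Rintegral => x _; rewrite !prodf_updE; ring.
Qed.

Let TZ c g : bdd g -> T (fun s => c * g s) = c * T g.
Proof.
move=> b1; rewrite /T -RintegralZl//; last exact: ig_bdd.
by apply: eq_Rintegral => x _; rewrite !prodf_updE; ring.
Qed.

Let eqT g1 g2 : (forall s, a 0 i < s < b 0 i -> g1 s = g2 s) -> T g1 = T g2.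
Proof.
move=> g12; apply: eq_Rintegral => x; rewrite inE => xab.
by rewrite !prodf_updE g12.
Qed.

Hypothesis Tcos : forall k, T (cosn k i) = 0.

Let continuous_polycos (p : {poly R}) : continuous (fun s => p.[cosn 1 i s]).
Proof.
move=> s; apply: (continuous_comp (@continuous_cosn 1 i s)).
exact: continuous_horner.
Qed.

(** The extra factor [cosn k] makes the induction on p work: multiplying p by X moves k to its
    neighbours k - 1 and k + 1, or 0 to 1. *)
Let T_polycos_mul (p : {poly R}) k : T (fun s => p.[cosn 1 i s] * cosn k i s) = 0.
Proof.
have bp (q : {poly R}) m : bdd (fun s => q.[cosn 1 i s] * cosn m i s).
  apply: bdd_continuous => s; apply: cvgM; first exact: continuous_polycos.
  exact: continuous_cosn.
have bc m : bdd (cosn m i) by apply: bdd_continuous; exact: continuous_cosn.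
elim/poly_ind: p k => [|p c IH] k.
  rewrite (@eqT _ (fun s => 0 * cosn 0 i s)); last by move=> s _; rewrite horner0 !mul0r.
  by rewrite TZ// mul0r.
case: k => [|k].
  rewrite (@eqT _ (fun s => p.[cosn 1 i s] * cosn 1 i s + c * cosn 0 i s)); last first.
    by move=> s _; rewrite hornerMXaddC cosn0 !mulr1.
  rewrite TD ?IH ?TZ ?Tcos ?mulr0 ?addr0//.
  apply: bdd_continuous => s; apply: cvgM; first exact: cvg_cst.
  exact: continuous_cosn.
rewrite (@eqT _ (fun s => (2^-1 * (p.[cosn 1 i s] * cosn k.+2 i s) +
    2^-1 * (p.[cosn 1 i s] * cosn k i s)) + c * cosn k.+1 i s)); last first.
  by move=> s _; rewrite hornerMXaddC mulrDl -mulrA cosn1_mul; ring.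
have bcM c' g : bdd g -> bdd (fun s => c' * g s).
  move=> [mg [M gM]]; split; first exact: measurable_funM.
  by exists (`|c'| * M) => s sab; rewrite normrM ler_wpM2l// gM.
have bD g1 g2 : bdd g1 -> bdd g2 -> bdd (fun s => g1 s + g2 s).
  move=> [mg1 [M1 gM1]] [mg2 [M2 gM2]]; split; first exact: measurable_funD.
  exists (M1 + M2) => s sab; rewrite (le_trans (ler_normD _ _))// lerD//.
  - exact: gM1.
  - exact: gM2.
rewrite TD; [|by apply: bD; apply: bcM|exact: bcM].
by rewrite TD ?TZ ?IH ?Tcos ?mulr0 ?addr0//; exact: bcM.
Qed.

(** Rescales the first cosine to [0, 1], where the threshold polynomials converge. *)
Let q (s : R) := 2^-1 * (1 + cosn 1 i s).

Let q01 s : 0 <= q s <= 1.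
Proof.
have h1 := cos_geN1 (1 * (pi / (b 0 i - a 0 i)) * (s - a 0 i)).
have h2 := cos_le1 (1 * (pi / (b 0 i - a 0 i)) * (s - a 0 i)).
by rewrite /q /cosn; apply/andP; split; lra.
Qed.

Let T_threshold t k : T (fun s => threshold t k (q s)) = 0.
Proof.
pose p : {poly R} := (1 - (2^-1 *: (1 + 'X)) ^+ k) ^+ threshold_exponent t k.
rewrite (@eqT _ (fun s => p.[cosn 1 i s] * cosn 0 i s)) ?T_polycos_mul//.
move=> s _; rewrite cosn0 mulr1 /p /threshold /q.
by rewrite !(hornerE, horner_exp).
Qed.

Let T_lt t : 0 < t < 1 -> T (fun s => if q s < t then 1 else 0) = 0.
Proof.
move=> t01; apply/esym.
have cq : continuous q.
  move=> s; apply: cvgM; first exact: cvg_cst.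
  by apply: cvgD; [exact: cvg_cst|exact: continuous_cosn].
have : (fun k : nat => T (fun s => threshold t k (q s))) @ \oo -->
    T (fun s => if q s < t then 1 else 0).
  apply: (prodf_convergence (C := fun j => if j == i then 1 else C j) fi).
  - move=> k j; rewrite /upd; case: eqP => [_|//].
    apply: continuous_measurable_fun => s.
    exact: (continuous_comp (cq s) (@continuous_threshold _ t k (q s))).
  - move=> k j s _; rewrite /upd; case: eqP => [_|//].
    exact: threshold_bounded.
  - move=> j s _; rewrite /upd; case: eqP => [_|_]; last exact: cvg_cst.
    exact: cvg_threshold.
rewrite (_ : (fun k => _) = fun=> 0); last by apply/funext => k; exact: T_threshold.
by move/(cvg_unique _ (cvg_cst 0)); exact.
Qed.

(** On the interval the first cosine decreases strictly, so c < s is the same as q s < q c. If c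
    lies outside the open interval, the ray restricts to the constant 1 or 0. *)
Lemma pairing_ray_eq0 c : T (fun s => if c < s then 1 else 0) = 0.
Proof.
have [ca|ac] := leP c (a 0 i).
  rewrite (@eqT _ (cosn 0 i)) ?Tcos// => s /andP[as_ _].
  by rewrite cosn0 (le_lt_trans ca as_).
have [bc|cb] := leP (b 0 i) c.
  rewrite (@eqT _ (fun s => 0 * cosn 0 i s)).
    by rewrite TZ ?mul0r//; apply: bdd_continuous; exact: continuous_cosn.
  by move=> s /andP[_ sb]; rewrite mul0r ltNge (le_trans (ltW sb) bc).
have arg s : a 0 i < s < b 0 i -> 0 < 1 * (pi / (b 0 i - a 0 i)) * (s - a 0 i) < pi.
  move=> /andP[as_ sb]; rewrite mul1r.
  have ba0 : 0 < b 0 i - a 0 i by rewrite subr_gt0.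
  rewrite !mulr_gt0 ?pi_gt0 ?invr_gt0 ?subr_gt0//= -mulrA gtr_pMr ?pi_gt0//.
  by rewrite mulrC ltr_pdivrMr// mul1r ltrD2r.
have argI s : a 0 i < s < b 0 i -> 1 * (pi / (b 0 i - a 0 i)) * (s - a 0 i) \in `[0, pi].
  by move=> /arg /andP[h1 h2]; rewrite in_itv/= !ltW.
have cab : a 0 i < c < b 0 i by rewrite ac cb.
rewrite (@eqT _ (fun s => if q s < q c then 1 else 0)); last first.
  move=> s sab; rewrite /q /cosn ltr_pM2l ?invr_gt0// ltrD2l.
  rewrite ltr_cos ?argI// mul1r ltr_pM2l ?ltrD2r//.
  by rewrite divr_gt0 ?pi_gt0// subr_gt0.
apply: T_lt; rewrite /q /cosn.
have /andP[h1 h2] := arg _ cab.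
have h3 : cos (1 * (pi / (b 0 i - a 0 i)) * (c - a 0 i)) < 1.
  by rewrite -[ltRHS]cos0 ltr_cos ?argI// in_itv/= lexx pi_ge0.
have h4 : -1 < cos (1 * (pi / (b 0 i - a 0 i)) * (c - a 0 i)).
  by rewrite -[ltLHS]cospi ltr_cos ?argI// in_itv/= lexx pi_ge0.
by apply/andP; split; lra.
Qed.

End one_coordinate.

Hypothesis f_cosn : forall k : 'I_n -> nat,
  \int[leb n]_(x in box a b) (f x * prodf (fun j => cosn (k j) j) x) = 0.

Let ray (c s : R) : R := if c < s then 1 else 0.

Let measurable_ray c : measurable_fun setT (ray c).
Proof.
rewrite (_ : ray c = \1_(`]c, +oo[%classic : set R)).
  exact: measurable_indic.
by apply/funext => s; rewrite /ray indicE mem_setE in_itv/= andbT; case: ifP.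
Qed.

Let f_rays (c : 'I_n -> R) :
  \int[leb n]_(x in box a b) (f x * prodf (fun j => ray (c j)) x) = 0.
Proof.
(* Coordinates are converted one at a time: rays in the first m, cosines in the others. The
   induction hypothesis for all k says that every cosine in coordinate m is annihilated, as
   [pairing_ray_eq0] demands. *)
suff H m : (m <= n)%N -> forall k : 'I_n -> nat, \int[leb n]_(x in box a b)
    (f x * prodf (fun j => if (j < m)%N then ray (c j) else cosn (k j) j) x) = 0.
  rewrite -[RHS](H n (leqnn n) (fun=> 0)); apply: eq_Rintegral => x _.
  by congr (_ * prodf _ _); apply/funext => j; rewrite ltn_ord.
elim: m => [_ k|m IH mn k]; first exact: f_cosn.
pose i := Ordinal mn.
pose h (j : 'I_n) := if (j < m)%N then ray (c j) else cosn (k j) j.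
rewrite (_ : (fun j => _) = upd h i (ray (c i))); last first.
  apply/funext => j; rewrite /upd /h ltnS leq_eqVlt.
  have [->|ji] := eqVneq j i; first by rewrite eqxx.
  by have /negbTE -> : (j != m :> nat) by apply: contra_neq ji => jm; exact: val_inj.
apply: (@pairing_ray_eq0 h (fun=> 1)).
- move=> j; rewrite /h; case: ifP => _; first exact: measurable_ray.
  by apply: continuous_measurable_fun; exact: continuous_cosn.
- move=> j s; rewrite /h; case: ifP => _; last exact: cos_max.
  by rewrite /ray; case: ifP => _; rewrite ?normr1 ?normr0.
- move=> l; rewrite -[RHS](IH (ltnW mn) (fun j => if j == i then l else k j)).
  apply: eq_Rintegral => x _; congr (_ * prodf _ _); apply/funext => j.
  rewrite /upd /h; have [->|//] := eqVneq j i.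
  by rewrite /= ltnn.
Qed.

Let quadrant (c : 'I_n -> R) : set 'rV[R]_n := [set x | forall j, c j < x 0 j].

Let quadrantE c : quadrant c = rect (fun j => `]c j, +oo[%classic).
Proof. by apply/seteqP; split => x xc j; have := xc j; rewrite /= in_itv/= andbT. Qed.

(** Quadrants are stable under intersection, and [f_rays] is the pairing of f with their indicators:
    exactly what a Dynkin argument starts from. *)
Let rV_measurable_quadrants : @measurable _ 'rV[R]_n =
  <<s [set A | exists c, A = quadrant c] >>.
Proof.
pose G := [set A | exists c, A = quadrant c].
apply/seteqP; split; last first.
  apply: smallest_sub; first exact: sigma_algebra_measurable.
  by move=> _ [c ->]; rewrite quadrantE; exact: measurable_rect.
apply: smallest_sub; first exact: smallest_sigma_algebra.
move=> A; rewrite -bigcup_seq/= => -[i _ [B mB <-]].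
have : measurable_fun setT (fun x : g_sigma_algebraType G => (x : 'rV[R]_n) 0 i).
  apply: (measurability _ (RGenOInfty.measurableE R)).
  move=> _ [_ [s ->] <-]; rewrite setTI.
  (* A half-space is exhausted by quadrants whose other corner coordinates go to minus infinity. *)
  rewrite (_ : _ @^-1` _ = \bigcup_k quadrant (fun j => if j == i then s else - k%:R)).
    apply: bigcupT_measurable => k; apply: sub_sigma_algebra.
    by exists (fun j => if j == i then s else - k%:R).
  apply/seteqP; split => [x /= xs|x [k _ /(_ i)]]; last by rewrite eqxx /= in_itv/= andbT.
  exists (Num.truncn (\sum_j `|x 0 j|)).+1 => // j; case: eqP => [->|_].
    by move: xs; rewrite in_itv/= andbT.
  have : `|x 0 j| < (Num.truncn (\sum_j `|x 0 j|)).+1%:R.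
    apply: le_lt_trans (truncnS_gt _).
    by rewrite (bigD1 j)//= lerDl sumr_ge0.
  by rewrite ltr_norml => /andP[].
by move=> /(_ measurableT _ mB).
Qed.

Let f_indic (A : set 'rV[R]_n) : measurable A ->
  \int[leb n]_(x in box a b) (f x * \1_A x) = 0.
Proof.
have gi B : measurable B -> (leb n).-integrable (box a b) (EFin \o (fun x => f x * \1_B x)).
  move=> mB; apply: (ig_mulbounded mbox (C := 1) fi); first exact: measurable_indic.
  by move=> x _; rewrite indicE; case: (_ \in _); rewrite ?normr1 ?normr0.
(* The quadrant with corner a - 1 contains the box, so there it serves as the whole space. *)
have fT : \int[leb n]_(x in box a b) (f x * \1_[set: 'rV[R]_n] x) = 0.
  rewrite -[RHS](f_rays (fun j => a 0 j - 1)); apply: eq_Rintegral => x; rewrite inE => xab.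
  rewrite indicT mulr1 /prodf big1 ?mulr1// => j _; rewrite /ray ifT//.
  by have /andP[aj _] := xab j; apply: lt_trans aj; rewrite gtrBl.
rewrite rV_measurable_quadrants.
apply: (@dynkin_induction _ _ [set A | exists c, A = quadrant c]
   (fun A => \int[leb n]_(x in box a b) (f x * \1_A x) = 0)).
- exact: rV_measurable_quadrants.
- move=> _ _ [c ->] [d ->]; exists (fun j => Num.max (c j) (d j)).
  apply/seteqP; split => [x [xc xd] j|x xcd]; first by rewrite gt_max xc xd.
  by split => j; have := xcd j; rewrite gt_max => /andP[].
- exact: fT.
- move=> _ [c ->]; rewrite -[RHS](f_rays c); apply: eq_Rintegral => x _; congr (_ * _).
  rewrite indicE; have [xc|xc] := pselect (quadrant c x).
    rewrite mem_set// /prodf big1// => j _.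
    by rewrite /ray ifT//; exact: xc.
  rewrite memNset//; move: xc => /existsNP[j /negP/negbTE xj].
  by rewrite (prodfD1 _ j) /ray xj mul0r.
- move=> B mB B0; rewrite -[RHS]subr0 -[X in _ = X - _]fT -[X in _ = _ - X]B0.
  rewrite -RintegralB//; [|exact: gi|exact: gi].
  apply: eq_Rintegral => x _; rewrite indicT !indicE in_setC.
  by case: (_ \in _); rewrite /= ?mulr1 ?mulr0 ?subrr ?subr0.
- move=> F mF tF F0.
  (* Disjointness gives the finite unions by addition; bounded convergence then gives the countable
     one. *)
  pose U k := \bigcup_(i < k) F i.
  have mU k : measurable (U k) by apply: bigcup_measurable => i _; exact: mF.
  have U0 k : \int[leb n]_(x in box a b) (f x * \1_(U k) x) = 0.
    elim: k => [|k IH].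
      rewrite /U bigcup_mkord big_ord0.
      rewrite (_ : \int[_]_(x in _) _ = \int[leb n]_(x in box a b) 0).
        by rewrite Rintegral_cst// mul0r.
      by apply: eq_Rintegral => x _; rewrite indic0 mulr0.
    rewrite -[RHS]addr0 -[X in _ = X + _]IH -[X in _ = _ + X](F0 k).
    rewrite -RintegralD//; [|exact: gi|exact: gi].
    apply: eq_Rintegral => x _; rewrite -mulrDr; congr (_ * _).
    rewrite !indicE; have [xF|xF] := pselect (F k x).
      rewrite (mem_set xF) mem_set; last by exists k => //=.
      rewrite memNset ?add0r// => -[i /= ik Fi].
      have ik' : i = k by apply: (tF i k) => //; exists x.
      by move: ik; rewrite ik' ltnn.
    rewrite (memNset xF) addr0; congr ((_ : bool)%:R).
    apply/idP/idP; rewrite !inE => -[i /= ik Fi]; exists i => //=.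
      move: ik; rewrite ltnS leq_eqVlt => /predU1P[ik|//].
      by move: Fi; rewrite ik.
    exact: leq_trans ik _.
  have : (fun k => \int[leb n]_(x in box a b) (f x * \1_(U k) x)) @ \oo -->
      \int[leb n]_(x in box a b) (f x * \1_(\bigcup_k F k) x).
    apply: (bounded_convergence mbox (C := 1) fi) => [k|k x _|x _].
    + exact: measurable_indic.
    + by rewrite indicE; case: (_ \in _); rewrite ?normr1 ?normr0.
    + have [[i _ Fi]|nF] := pselect ((\bigcup_k F k) x).
        apply: cvg_near_cst; exists i.+1 => // k /= ik.
        by rewrite !indicE !mem_set//; exists i.
      apply: cvg_near_cst; apply: nearW => k.
      by rewrite !indicE !memNset// => -[i _ Fi]; apply: nF; exists i.
  rewrite (_ : (fun k => _) = fun=> 0); last by apply/funext => k; exact: U0.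
  by move/(cvg_unique _ (cvg_cst 0)) => <-.
Qed.

Theorem cosines_total : {ae leb n, forall x, box a b x -> f x = 0}.
Proof.
have h : ae_eq (leb n) (box a b) (EFin \o f) (cst 0%E).
  apply: integral_ae_eq => // E Eab mE.
  rewrite integral0; have fiE : (leb n).-integrable E (EFin \o f).
    exact: integrableS fi.
  rewrite -[LHS]fineK; last exact: integrable_fin_num.
  congr (_%:E); rewrite -[RHS](f_indic mE).
  transitivity (\int[leb n]_(x in box a b `&` E) f x).
    by rewrite (setIidr Eab).
  rewrite Rintegral_mkcondr.
  apply: eq_Rintegral => x _; rewrite patchE indicE.
  by case: (x \in E); rewrite ?mulr1 ?mulr0.
by apply: filterS h => x h /h [].
Qed.

End totality.

(** * Weak solutions and Neumann eigenfunctions *)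

Section sin_lipschitz.
Context {R : realType}.

Lemma sin_lip (x y : R) : `|sin x - sin y| <= `|x - y|.
Proof.
wlog xy : x y / x < y => [H|].
  have [xy|yx|->] := ltgtP x y; first exact: H.
    by rewrite distrC [leRHS]distrC; exact: H.
  by rewrite !subrr.
have [c _ E] : exists2 c, c \in `]x, y[ & sin y - sin x = cos c * (y - x).
  exact: (MVT xy (fun z _ => is_derive_sin z) (continuous_subspaceT (@continuous_sin R))).
rewrite distrC E normrM [`|x - y|]distrC ler_piMl//.
exact: cos_max.
Qed.

Lemma sin_mulpi (k : nat) : sin (k%:R * pi) = 0 :> R.
Proof.
elim: k => [|k IH]; first by rewrite mul0r sin0.
by rewrite -natr1 mulrDl mul1r sinDpi IH oppr0.
Qed.

End sin_lipschitz.

Section H1_theory.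
Context {R : realType} (m : nat) (a b : 'rV[R]_m.+1).
Local Notation n := m.+1.
Hypothesis ab : forall i, a 0 i < b 0 i.
Implicit Types (u v w g : 'rV[R]_n -> R) (k : 'I_n -> nat).

Let mbox : measurable (box a b) := measurable_box a b.
Let boxoo : (leb n (box a b) < +oo)%E := leb_box_lty a b.

Definition kappa j : R := pi / (b 0 j - a 0 j).

Lemma kappa_gt0 j : 0 < kappa j.
Proof. by rewrite divr_gt0 ?pi_gt0// subr_gt0. Qed.

Definition cosprod k : 'rV[R]_n -> R := prodf (fun j => cosn a b (k j) j).

Definition eigval k : R := \sum_j ((k j)%:R * kappa j) ^+ 2.

Let C1R_cosn (l : nat) j : C1R (cosn a b l j)
  (fun s => - sin (l%:R * kappa j * (s - a 0 j)) * (l%:R * kappa j)).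
Proof. exact: C1R_comp C1R_cos (C1R_affine _ _). Qed.

Lemma C1_cosprod k : C1 (cosprod k).
Proof. exact: C1_prodf (fun j => C1R_cosn (k j) j). Qed.

(** The difference is orthogonal to every compactly supported test function, hence by cutting off to
    every product of cosines, and totality makes it null. *)
Lemma weak_gradient_unique u G G' : weak_gradient a b u G -> weak_gradient a b u G' ->
  forall i, {ae leb n, forall x, box a b x -> G i x = G' i x}.
Proof.
move=> uG uG' i; have [G2 GE] := uG i; have [G'2 GE'] := uG' i.
have Gi := sqi_ig mbox boxoo G2; have Gi' := sqi_ig mbox boxoo G'2.
have di := igB mbox Gi Gi'.
have : {ae leb n, forall x, box a b x -> G i x - G' i x = 0}.
  apply: (cosines_total ab di) => k.
  apply: (Rintegral_prodf_eq0 ab (fun j => C1R_cosn (k j) j) di) => phi cphi.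
  have phi2 := C1_L2 a b cphi.1.
  rewrite (_ : \int[_]_(x in _) _ =
    \int[leb n]_(x in box a b) (G i x * phi x - G' i x * phi x)); last first.
    by apply: eq_Rintegral => x _; rewrite mulrBl.
  rewrite RintegralB//; [|exact: sqi_mul|exact: sqi_mul].
  by rewrite -[X in X - _]opprK -[X in _ - X]opprK -GE// -GE'// subrr.
by apply: filterS => x h /h /eqP; rewrite subr_eq0 => /eqP.
Qed.

Lemma grad_spec u : H1 a b u -> weak_gradient a b u (grad a b u).
Proof. by move=> [_ uG]; exact: (xgetPex _ uG). Qed.

Lemma grad_L2 i u : H1 a b u -> L2 a b (grad a b u i).
Proof. by move=> /grad_spec /(_ i) []. Qed.

Lemma C1_H1 v : C1 v -> H1 a b v.
Proof.
move=> Cv; split; first exact: C1_L2.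
by exists (fun i => partial i v); exact: weak_gradient_C1.
Qed.

Lemma grad_eq_C1 u v i : H1 a b u -> C1 v ->
  {ae leb n, forall x, box a b x -> u x = v x} ->
  {ae leb n, forall x, box a b x -> grad a b u i x = partial i v x}.
Proof.
move=> uH Cv uv.
suff uG : weak_gradient a b u (fun i => partial i v).
  exact: (weak_gradient_unique (grad_spec uH) uG).
move=> {}i; split; first exact: C1_partial_L2.
move=> phi cphi; rewrite -(weak_gradient_C1 ab Cv i).2//.
have [u2 _] := uH.
apply: eq_Rintegral_ae => //.
- by apply: measurable_funM; [case: u2|case: (C1_partial_L2 a b i cphi.1)].
- by apply: measurable_funM; [case: (C1_L2 a b Cv)|case: (C1_partial_L2 a b i cphi.1)].
- by apply: filterS uv => x h xab; rewrite h.
Qed.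

Lemma dirichlet_formC u v : dirichlet_form a b u v = dirichlet_form a b v u.
Proof. by apply: eq_Rintegral => x _; apply: eq_bigr => i _; rewrite mulrC. Qed.

Lemma dirichlet_form_C1 u v : H1 a b u -> C1 v ->
  dirichlet_form a b u v =
  \sum_i \int[leb n]_(x in box a b) (grad a b u i x * partial i v x).
Proof.
move=> uH Cv; rewrite /dirichlet_form Rintegral_sum//; last first.
  by move=> i; exact: (sqi_mul mbox (grad_L2 i uH) (grad_L2 i (C1_H1 Cv))).
apply: eq_bigr => i _.
have gv := grad_eq_C1 i (C1_H1 Cv) Cv (aeW _ (fun x _ => erefl)).
apply: eq_Rintegral_ae => //.
- apply: measurable_funM; first by case: (grad_L2 i uH).
  by case: (grad_L2 i (C1_H1 Cv)).
- apply: measurable_funM; first by case: (grad_L2 i uH).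
  by case: (C1_partial_L2 a b i Cv).
- by apply: filterS gv => x h xab; rewrite h.
Qed.

(** This sine vanishes at both ends because kappa (b - a) = pi. Being Lipschitz, it is bounded by a
    multiple of the distance to either end, and min(p, q) <= 2 p q / (p + q). *)
Lemma sin_le_dist (l : nat) j (s : R) : a 0 j < s < b 0 j ->
  `|sin (l%:R * kappa j * (s - a 0 j))| <=
  l%:R * kappa j * (2 / (b 0 j - a 0 j)) * ((s - a 0 j) * (b 0 j - s)).
Proof.
move=> /andP[as_ sb].
set t := l%:R * kappa j.
have t0 : 0 <= t by rewrite mulr_ge0// ltW// kappa_gt0.
have d0 : 0 < b 0 j - a 0 j by rewrite subr_gt0.
have h1 : `|sin (t * (s - a 0 j))| <= t * (s - a 0 j).
  have := sin_lip (t * (s - a 0 j)) 0; rewrite sin0 !subr0 => /le_trans; apply.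
  by rewrite ger0_norm// mulr_ge0// subr_ge0 ltW.
have h2 : `|sin (t * (s - a 0 j))| <= t * (b 0 j - s).
  have := sin_lip (t * (s - a 0 j)) (l%:R * pi); rewrite sin_mulpi subr0 => /le_trans; apply.
  rewrite (_ : _ - _ = - (t * (b 0 j - s))).
    by rewrite normrN ger0_norm// mulr_ge0// subr_ge0 ltW.
  by rewrite /t /kappa; field; rewrite gt_eqF.
rewrite -mulrA.
suff [h|h] : s - a 0 j <= (2 / (b 0 j - a 0 j)) * ((s - a 0 j) * (b 0 j - s)) \/
  b 0 j - s <= (2 / (b 0 j - a 0 j)) * ((s - a 0 j) * (b 0 j - s)).
- by apply: (le_trans h1); rewrite ler_wpM2l.
- by apply: (le_trans h2); rewrite ler_wpM2l.
have p0 : 0 < s - a 0 j by rewrite subr_gt0.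
have q0 : 0 < b 0 j - s by rewrite subr_gt0.
have -> : b 0 j - a 0 j = (s - a 0 j) + (b 0 j - s) by ring.
move: (s - a 0 j) (b 0 j - s) p0 q0 => p q p0 q0.
have pq0 : 0 < p + q by rewrite addr_gt0.
by have [pq|qp] := leP p q; [left|right]; rewrite mulrAC ler_pdivlMr//; nra.
Qed.

(* Integration by parts needs no boundary term since the normal derivative of
   a product of cosines vanishes on each face. *)
Lemma cosprod_ibp u G i k : L2 a b u -> weak_gradient a b u G ->
  \int[leb n]_(x in box a b) (G i x * partial i (cosprod k) x) =
  ((k i)%:R * kappa i) ^+ 2 * \int[leb n]_(x in box a b) (u x * cosprod k x).
Proof.
move=> u2 uG; set t := (k i)%:R * kappa i.
pose c j := cosn a b (k j) j.
pose c' j s := - sin ((k j)%:R * kappa j * (s - a 0 j)) * ((k j)%:R * kappa j).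
have Cc j : C1R (c j) (c' j) by exact: C1R_cosn.
pose e := upd c i (c' i).
pose e' := upd c' i (fun s => - t ^+ 2 * c i s).
have Ce j : C1R (e j) (e' j).
  rewrite /e /e' /upd; case: ifP => _; last exact: Cc.
  apply: eq_C1R (C1R_M (C1R_cst (- t)) (C1R_comp C1R_sin (C1R_affine t (a 0 i)))) => s.
    by rewrite /c' -/t mulrC mulNr mulrN.
  by rewrite /c /cosn -/(kappa i) -/t; ring.
have pE : partial i (cosprod k) = prodf e by exact: partial_prodf Cc.
have ppE x : partial i (prodf e) x = - t ^+ 2 * cosprod k x.
  rewrite (partial_prodf i Ce) prodf_updE /e' /upd eqxx /cosprod (prodfD1 _ i) mulrA.
  congr (_ * _); apply: eq_bigr => j ji.
  by rewrite /e /upd (negbTE ji).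
have t0 : 0 <= t by rewrite mulr_ge0// ltW// kappa_gt0.
have C0 : 0 <= t * (t * (2 / (b 0 i - a 0 i))).
  by rewrite mulr_ge0// mulr_ge0// divr_ge0// subr_ge0 ltW.
have hi s : a 0 i < s < b 0 i ->
    `|e i s| <= t * (t * (2 / (b 0 i - a 0 i))) * ((s - a 0 i) * (b 0 i - s)).
  move=> sab; rewrite /e /upd eqxx /c' -/t normrM normrN (ger0_norm t0) mulrC.
  by rewrite -[leRHS]mulrA ler_wpM2l//; exact: sin_le_dist.
have := weak_integration_by_parts ab Ce u2 uG C0 hi.
rewrite pE => /eqP; rewrite -eqr_oppLR => /eqP <-.
have uphi : (leb n).-integrable (box a b) (EFin \o (fun x => u x * cosprod k x)).
  exact: (sqi_mul mbox u2 (C1_L2 a b (C1_cosprod k))).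
rewrite -RintegralZl// -[LHS]mulN1r -RintegralZl//; last first.
  apply: (sqi_mul mbox u2); apply: continuous_sqi_box.
  rewrite (_ : partial i _ = fun x => - t ^+ 2 * cosprod k x); last exact/funext.
  exact: (C1_continuous (C1_M (C1_cst _ (- t ^+ 2)) (C1_cosprod k))).
by apply: eq_Rintegral => x _; rewrite ppE; ring.
Qed.

Lemma dirichlet_form_cosprod u k : H1 a b u ->
  dirichlet_form a b u (cosprod k) =
  eigval k * \int[leb n]_(x in box a b) (u x * cosprod k x).
Proof.
move=> uH; rewrite (dirichlet_form_C1 uH (C1_cosprod k)) mulr_suml.
by apply: eq_bigr => i _; exact: cosprod_ibp uH.1 (grad_spec uH).
Qed.

Lemma cosprod_eigenfunction k : neumann_eigenfunction a b (eigval k) (cosprod k).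
Proof.
split; first exact: C1_H1 (C1_cosprod k).
move=> phi phiH; rewrite dirichlet_formC dirichlet_form_cosprod//.
by congr (_ * _); apply: eq_Rintegral => x _; rewrite mulrC.
Qed.

(** Distinct indices may share an eigenvalue, so a coordinate i with k_i != l_i is isolated:
    integrating the product of the i-th partial derivatives by parts in both ways yields different
    factors. *)
Lemma cosprod_orthogonal k l : k <> l ->
  \int[leb n]_(x in box a b) (cosprod k x * cosprod l x) = 0.
Proof.
move=> kl; have [i /eqP kli] : exists i, k i <> l i.
  by apply/existsNP => h; apply: kl; exact/funext.
have ibp (p q : 'I_n -> nat) :
    \int[leb n]_(x in box a b) (partial i (cosprod p) x * partial i (cosprod q) x) =
    ((q i)%:R * kappa i) ^+ 2 * \int[leb n]_(x in box a b) (cosprod p x * cosprod q x).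
  exact: (cosprod_ibp i q (C1_L2 a b (C1_cosprod p)) (weak_gradient_C1 ab (C1_cosprod p))).
have E1 := ibp k l; have := ibp l k.
under eq_Rintegral do rewrite mulrC.
rewrite E1; under [in RHS]eq_Rintegral do rewrite mulrC.
move/eqP; rewrite -subr_eq0 -mulrBl mulf_eq0 => /orP[|/eqP//].
rewrite [X in X - _]exprMn [X in _ - X]exprMn -mulrBl mulf_eq0 [X in _ || X]expf_eq0/= (gt_eqF (kappa_gt0 i)) orbF.
rewrite subr_eq0 eqrXn2// eqr_nat => /eqP lk.
by rewrite lk eqxx in kli.
Qed.

Lemma L2_boundary_C1 v : C1 v -> L2_boundary a b v.
Proof.
move=> Cv i; split; apply: continuous_sqi_box => y;
  exact: (cvg_comp _ _ (@insert_coord_continuous2 R m i _ y) (C1_continuous Cv _)).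
Qed.

Let mface i : measurable (face a b i).
Proof. exact: measurable_box. Qed.

Let faceoo i : (leb m (face a b i) < +oo)%E.
Proof. exact: leb_box_lty. Qed.

Lemma boundary_intE v : L2_boundary a b v ->
  boundary_int a b v = \sum_(i < n) \int[leb m]_(y in face a b i)
    (v (@insert_coord R n i (a 0 i) y) + v (@insert_coord R n i (b 0 i) y)).
Proof.
move=> v2; apply: eq_bigr => i _; rewrite RintegralD//.
- exact: (sqi_ig (mface i) (faceoo i) (v2 i).1).
- exact: (sqi_ig (mface i) (faceoo i) (v2 i).2).
Qed.

Lemma cvg_boundary_int (v_ : nat -> 'rV[R]_n -> R) g :
  (forall l, L2_boundary a b (v_ l)) -> L2_boundary a b g ->
  boundary_int a b (fun x => (v_ l x - g x) ^+ 2) @[l --> \oo] --> (0 : R) ->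
  boundary_int a b (v_ l) @[l --> \oo] --> boundary_int a b g.
Proof.
move=> v2 g2 vg.
have face_cvg (ins : forall i, 'rV[R]_m -> 'rV[R]_n) i :
    (forall l, square_integrable (leb m) (face a b i) (fun y => v_ l (ins i y))) ->
    square_integrable (leb m) (face a b i) (fun y => g (ins i y)) ->
    (forall l, \int[leb m]_(y in face a b i) (v_ l (ins i y) - g (ins i y)) ^+ 2 <=
       boundary_int a b (fun x => (v_ l x - g x) ^+ 2)) ->
    (\int[leb m]_(y in face a b i) v_ l (ins i y)) @[l --> \oo] -->
    \int[leb m]_(y in face a b i) g (ins i y).
  move=> vi2 gi2 le.
  have one2 : square_integrable (leb m) (face a b i) (fun=> 1).
    by apply: (sqi_bounded (mface i) (faceoo i) (C := 1)) => // y _; rewrite normr1.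
  have h : (\int[leb m]_(y in face a b i) (v_ l (ins i y) - g (ins i y)) ^+ 2) @[l --> \oo] --> (0 : R).
    apply: (squeeze_cvgr _ (cvg_cst 0) vg); apply: nearW => l; rewrite le andbT.
    by apply: Rintegral_ge0 => y _; exact: sqr_ge0.
  have := cvg_Rintegral_mul_L2 (mface i) vi2 gi2 one2 h.
  under eq_fun do under eq_Rintegral do rewrite mulr1.
  by under [in X in _ --> X]eq_Rintegral do rewrite mulr1.
have pos l i : 0 <= \int[leb m]_(y in face a b i)
    (v_ l (@insert_coord R n i (a 0 i) y) - g (@insert_coord R n i (a 0 i) y)) ^+ 2 /\
   0 <= \int[leb m]_(y in face a b i)
    (v_ l (@insert_coord R n i (b 0 i) y) - g (@insert_coord R n i (b 0 i) y)) ^+ 2.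
  by split; apply: Rintegral_ge0 => y _; exact: sqr_ge0.
apply: cvg_big => [|i _]; first exact: add_continuous.
apply: cvgD.
- apply: (face_cvg (fun i => @insert_coord R n i (a 0 i))) => [l||l].
  + by case: (v2 l i).
  + by case: (g2 i).
  + rewrite /boundary_int (bigD1 i)//= -addrA lerDl addr_ge0//.
      by case: (pos l i).
    by apply: sumr_ge0 => j _; case: (pos l j) => *; exact: addr_ge0.
- apply: (face_cvg (fun i => @insert_coord R n i (b 0 i))) => [l||l].
  + by case: (v2 l i).
  + by case: (g2 i).
  + rewrite /boundary_int (bigD1 i)//= addrAC lerDr addr_ge0//.
      by case: (pos l i).
    by apply: sumr_ge0 => j _; case: (pos l j) => *; exact: addr_ge0.
Qed.

Section normal_field.
(* A vector field (F_i(x_i))_i which coincides with the outer unit normal on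
   the boundary. *)
Variables F F' : 'I_n -> R -> R.
Hypothesis CF : forall i, C1R (F i) (F' i).
Hypothesis Fa : forall i, F i (a 0 i) = -1.
Hypothesis Fb : forall i, F i (b 0 i) = 1.

Let F2 i : L2 a b (fun x => F i (x 0 i)).
Proof. exact: C1_L2 (C1_coord i (CF i)). Qed.

Let F'2 i : L2 a b (fun x => F' i (x 0 i)).
Proof.
apply: continuous_sqi_box => x.
exact: (cvg_comp _ _ (@coord_continuous _ _ _ 0 i x) ((CF i).2 (x 0 i))).
Qed.

Lemma boundary_int_C1 v : C1 v ->
  boundary_int a b v = \sum_i (\int[leb n]_(x in box a b) (partial i v x * F i (x 0 i)) +
                               \int[leb n]_(x in box a b) (v x * F' i (x 0 i))).
Proof.
move=> Cv; rewrite (boundary_intE (L2_boundary_C1 Cv)); apply: eq_bigr => i _.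
rewrite -RintegralD//; last 2 first.
- exact: (sqi_mul mbox (C1_partial_L2 a b i Cv) (F2 i)).
- exact: (sqi_mul mbox (C1_L2 a b Cv) (F'2 i)).
rewrite (green (ab i) Cv (CF i).1 (CF i).2); apply: eq_Rintegral => y _.
by rewrite Fa Fb mulr1 mulrN1 opprK addrC.
Qed.

(** Both sides of [boundary_int_C1] pass to the limit along the approximants. Since g is absent from
    the right-hand side, all traces of u have the same boundary integral, whichever one [trace]
    picks. *)
Lemma boundary_int_trace u g : H1 a b u -> is_trace a b u g ->
  boundary_int a b g =
  \sum_i (\int[leb n]_(x in box a b) (grad a b u i x * F i (x 0 i)) +
          \int[leb n]_(x in box a b) (u x * F' i (x 0 i))).
Proof.
move=> uH [g2 [v [Cv vu dvu vg]]].
have lim1 := cvg_boundary_int (fun l => L2_boundary_C1 (Cv l)) g2 vg.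
suff : boundary_int a b (v l) @[l --> \oo] -->
    \sum_i (\int[leb n]_(x in box a b) (grad a b u i x * F i (x 0 i)) +
          \int[leb n]_(x in box a b) (u x * F' i (x 0 i))).
  by move/(cvg_unique _ lim1); exact.
rewrite (_ : (fun l => _) = fun l =>
   \sum_i (\int[leb n]_(x in box a b) (partial i (v l) x * F i (x 0 i)) +
            \int[leb n]_(x in box a b) (v l x * F' i (x 0 i)))); last first.
  by apply/funext => l; exact: boundary_int_C1.
apply: cvg_big => [|i _]; first exact: add_continuous.
apply: cvgD.
- exact: (cvg_Rintegral_mul_L2 mbox (fun l => C1_partial_L2 a b i (Cv l))
    (grad_L2 i uH) (F2 i) (dvu i)).
- exact: (cvg_Rintegral_mul_L2 mbox (fun l => C1_L2 a b (Cv l)) uH.1 (F'2 i) vu).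
Qed.

End normal_field.

(** The approximating sequence is constant, equal to v. *)
Lemma is_trace_C1 u v : H1 a b u -> C1 v ->
  {ae leb n, forall x, box a b x -> u x = v x} -> is_trace a b u v.
Proof.
move=> uH Cv uv; split; first exact: L2_boundary_C1.
have z (d : measure_display) (T : measurableType d) (mu : {measure set T -> \bar R})
    (D : set T) : measurable D -> \int[mu]_(x in D) (0 : R) = 0.
  by move=> mD; rewrite Rintegral_cst// mul0r.
exists (fun=> v); split => //.
- rewrite (_ : \int[_]_(x in _) _ = 0); first exact: cvg_cst.
  rewrite -[RHS](z _ _ (leb n) _ mbox); apply: eq_Rintegral_ae => //.
    by apply: measurable_funX; apply: measurable_funB; [case: (C1_L2 a b Cv)|case: uH => -[]].
  by apply: filterS uv => x h xab; rewrite h// subrr expr0n.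
- move=> i; rewrite (_ : \int[_]_(x in _) _ = 0); first exact: cvg_cst.
  rewrite -[RHS](z _ _ (leb n) _ mbox); apply: eq_Rintegral_ae => //.
    apply: measurable_funX; apply: measurable_funB; first by case: (C1_partial_L2 a b i Cv).
    by case: (grad_L2 i uH).
  by apply: filterS (grad_eq_C1 i uH Cv uv) => x h xab; rewrite h// subrr expr0n.
- rewrite (_ : boundary_int _ _ _ = 0); first exact: cvg_cst.
  apply: big1 => i _.
  by rewrite -[RHS]addr0; congr (_ + _); rewrite -[RHS](z _ _ (leb m) _ (mface i));
    apply: eq_Rintegral => y _; rewrite subrr expr0n.
Qed.

Lemma is_trace_trace u g : is_trace a b u g -> is_trace a b u (trace a b u).
Proof. by move=> ug; exact: (xgetPex _ (ex_intro _ g ug)). Qed.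

End H1_theory.

#[local] Arguments leb : simpl never.

(** * Upper bound for the second Neumann eigenvalue *)

Section neumann_eigenvalues.
Context {R : realType} (m : nat) (a b : 'rV[R]_m.+1).
Local Notation n := m.+1.
Hypothesis ab : forall i, a 0 i < b 0 i.
Implicit Types (u v w g : 'rV[R]_n -> R) (k : 'I_n -> nat).

Let mbox : measurable (box a b) := measurable_box a b.
Let boxoo : (leb n (box a b) < +oo)%E := leb_box_lty a b.

Definition face_volume i : R := fine (leb m (face a b i)).

Definition volume : R := fine (leb n (box a b)).

Lemma face_volume_gt0 i : 0 < face_volume i.
Proof.
rewrite /face_volume leb_box => [|j]; last by rewrite !mxE ltW.
by rewrite /= prodr_gt0// => j _; rewrite !mxE subr_gt0.
Qed.

Lemma Rintegral_box_coord i (F F' : R -> R) : C1R F F' ->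
  \int[leb n]_(x in box a b) F' (x 0 i) = face_volume i * (F (b 0 i) - F (a 0 i)).
Proof.
move=> [dF cF].
have := green (ab i) (C1_cst n (1 : R)) dF cF.
rewrite partial_cst.
under [X in X = _ -> _]eq_Rintegral do rewrite mul0r add0r mul1r.
move=> ->; under eq_Rintegral do rewrite !mul1r.
by rewrite Rintegral_cst 1?mulrC//; exact: measurable_box.
Qed.

Lemma volumeE i : volume = face_volume i * (b 0 i - a 0 i).
Proof.
rewrite -(Rintegral_box_coord i C1R_id) Rintegral_cst//.
by rewrite mul1r.
Qed.

Lemma volume_gt0 : 0 < volume.
Proof. by rewrite (volumeE ord0) mulr_gt0 ?face_volume_gt0// subr_gt0. Qed.

Definition unit_index i : 'I_n -> nat := fun j => (j == i).

Lemma cosprod0 : cosprod a b (fun=> 0%N) = fun=> 1.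
Proof. by apply/funext => x; rewrite /cosprod /prodf big1// => j _; exact: cosn0. Qed.

Lemma cosprod_unit i x :
  cosprod a b (unit_index i) x = cos (kappa a b i * (x 0 i - a 0 i)).
Proof.
rewrite /cosprod (prodfD1 _ i) /unit_index eqxx big1 ?mulr1.
  by rewrite /cosn mul1r.
by move=> j /negbTE ->; exact: cosn0.
Qed.

Lemma eigval_unit i : eigval a b (unit_index i) = kappa a b i ^+ 2.
Proof.
rewrite /eigval (bigD1 i)//= /unit_index eqxx mul1r big1 ?addr0//.
by move=> j /negbTE ->; rewrite mul0r expr0n.
Qed.

Lemma cosprod_unit_norm i :
  \int[leb n]_(x in box a b) (cosprod a b (unit_index i) x ^+ 2) = volume / 2.
Proof.
(* The primitive sin cos vanishes at both ends and has derivative kappa (cos^2 - sin^2) = 2 kappa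
   cos^2 - kappa, so the mean of cos^2 is 1/2. *)
have C := C1R_M (C1R_comp C1R_sin (C1R_affine (kappa a b i) (a 0 i)))
  (C1R_comp C1R_cos (C1R_affine (kappa a b i) (a 0 i))).
have := Rintegral_box_coord i C; rewrite subrr mulr0 sin0 mul0r subr0.
have k0 := kappa_gt0 ab i.
rewrite (_ : kappa a b i * (b 0 i - a 0 i) = pi) ?sinpi ?mul0r ?mulr0; last first.
  by rewrite /kappa divfK// subr_eq0 gt_eqF.
rewrite (_ : \int[_]_(x in _) _ = \int[leb n]_(x in box a b)
   ((2 * kappa a b i) * (cosprod a b (unit_index i) x ^+ 2) - kappa a b i)); last first.
  apply: eq_Rintegral => x _; rewrite cosprod_unit /=.
  have := cos2Dsin2 (kappa a b i * (x 0 i - a 0 i)).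
  move: (cos _) (sin _) => c s cs.
  rewrite [X in _ = _ - X](_ : _ = kappa a b i * (c ^+ 2 + s ^+ 2)); first by ring.
  by rewrite cs mulr1.
have c2 := (C1_L2 a b (C1_cosprod a b (unit_index i))).2.
rewrite RintegralB//; [|exact: (igZ mbox _ c2)|exact: (ig_cst mbox boxoo)].
rewrite RintegralZl// Rintegral_cst// -/volume => /eqP; rewrite subr_eq0 => /eqP h.
apply: (mulfI (x := 2 * kappa a b i)); first by rewrite mulf_neq0// gt_eqF.
by rewrite h; field.
Qed.

Lemma cosprod_const_norm :
  \int[leb n]_(x in box a b) (cosprod a b (fun=> 0%N) x ^+ 2) = volume.
Proof.
rewrite cosprod0; under eq_Rintegral do rewrite expr1n.
by rewrite Rintegral_cst// mul1r.
Qed.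

Lemma lin_indep_cosprod i : lin_indep_ae a b
  (fun j : 'I_2 => cosprod a b (if j == 0 then fun=> 0%N else unit_index i)).
Proof.
set w := fun j => _; move=> t t0 l.
have w2 j : L2 a b (w j) by exact: C1_L2 (C1_cosprod _ _ _).
have wl0 : \int[leb n]_(x in box a b) (w l x ^+ 2) != 0.
  have [->|->] : w l = cosprod a b (fun=> 0%N) \/ w l = cosprod a b (unit_index i).
    by rewrite /w; case: eqP; [left|right].
    by rewrite cosprod_const_norm gt_eqF// volume_gt0.
  by rewrite cosprod_unit_norm gt_eqF// divr_gt0// volume_gt0.
have E : \int[leb n]_(x in box a b) ((\sum_(j < 2) t j * w j x) * w l x) = 0.
  transitivity (\int[leb n]_(x in box a b) (0 : R)); last first.
    by rewrite Rintegral_cst// mul0r.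
  apply: eq_Rintegral_ae => //; last by apply: filterS t0 => x h xab /=; rewrite h// mul0r.
  apply: measurable_funM; last by case: (w2 l).
  by apply: measurable_sum => j; apply: measurable_funM => //; case: (w2 j).
apply: (mulIf wl0); rewrite mul0r -[RHS]E.
under [RHS]eq_Rintegral do rewrite mulr_suml.
have ww j : (leb n).-integrable (box a b) (EFin \o (fun x => w j x * w l x)).
  exact: (sqi_mul mbox (w2 j) (w2 l)).
rewrite Rintegral_sum//; last first.
  move=> j; apply: (eq_integrable mbox (EFin \o (fun x => t j * (w j x * w l x)))).
    by move=> x _ /=; rewrite mulrA.
  exact: (igZ mbox _ (ww j)).
have term j : \int[leb n]_(x in box a b) (t j * w j x * w l x) =
    t j * \int[leb n]_(x in box a b) (w j x * w l x).
  by rewrite -RintegralZl//; apply: eq_Rintegral => x _; rewrite mulrA.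
rewrite (bigD1 l)//= big1 ?addr0 => [|j jl]; rewrite term; last first.
  rewrite (cosprod_orthogonal ab) ?mulr0// => e.
  have aux (p q : 'I_2) : p != q -> (p == 0) != (q == 0).
    by case: p q => [[|[|//]] p] [[|[|//]] q]; rewrite -!val_eqE.
  move: (aux _ _ jl); have := congr1 (fun k => k i) e; rewrite /unit_index.
  by case: (j == 0); case: (l == 0); rewrite ?eqxx.
by congr (_ * _); apply: eq_Rintegral => x _; rewrite expr2.
Qed.

Let S2 : set R := [set mu | exists (lambda : 'I_2 -> R) (w : 'I_2 -> 'rV[R]_n -> R),
    (forall j, neumann_eigenfunction a b (lambda j) (w j) /\ lambda j <= mu) /\
    lin_indep_ae a b w].

(** A lower bound is what makes the infimum of [S2] usable. An independent family has a nonzero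
    first member, and its eigenvalue is a Rayleigh quotient. *)
Let S2_ge0 mu : S2 mu -> 0 <= mu.
Proof.
move=> [lambda [w [wE wi]]].
have [[wH /(_ _ wH) Dw] le0] := wE 0; apply: le_trans le0.
have w2 : L2 a b (w 0) by case: wH.
have I0 : 0 <= \int[leb n]_(x in box a b) (w 0 x ^+ 2).
  by apply: Rintegral_ge0 => x _; exact: sqr_ge0.
have Ipos : 0 < \int[leb n]_(x in box a b) (w 0 x ^+ 2).
  rewrite lt_neqAle I0 andbT eq_sym; apply/eqP => /(ae0_Rintegral_sqr mbox w2) w0.
  have /(wi _)/(_ 0)/eqP : {ae leb n, forall x, box a b x ->
      \sum_(j < 2) (if j == 0 then 1 else 0) * w j x = 0}.
    apply: filterS w0 => x h xab.
    by rewrite (bigD1 0)//= mul1r h// add0r big1// => j /negbTE ->; rewrite mul0r.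
  by rewrite eqxx oner_eq0.
rewrite -(pmulr_lge0 _ Ipos).
have -> : lambda 0 * \int[leb n]_(x in box a b) (w 0 x ^+ 2) = dirichlet_form a b (w 0) (w 0).
  by rewrite Dw; congr (_ * _); apply: eq_Rintegral => x _; rewrite expr2.
apply: Rintegral_ge0 => x _; apply: sumr_ge0 => i _.
by rewrite -expr2 sqr_ge0.
Qed.

Let S2_unit i : S2 (kappa a b i ^+ 2).
Proof.
pose k (j : 'I_2) := if j == 0 then fun=> 0%N else unit_index i.
exists (fun j => eigval a b (k j)), (fun j => cosprod a b (k j)).
split; last exact: lin_indep_cosprod.
move=> j; split; first exact: cosprod_eigenfunction.
rewrite /k; case: eqP => _; last by rewrite eigval_unit.
by rewrite /eigval big1 ?sqr_ge0// => l _; rewrite mul0r expr0n.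
Qed.

Lemma neumann_eigenvalue2_ge0 : 0 <= neumann_eigenvalue a b 2.
Proof.
by apply: lb_le_inf; [exists (kappa a b ord0 ^+ 2); exact: S2_unit|exact: S2_ge0].
Qed.

(** The constant and the single cosine in coordinate i are independent eigenfunctions, with
    eigenvalues 0 and kappa_i^2. *)
Lemma neumann_eigenvalue2_le i : neumann_eigenvalue a b 2 <= kappa a b i ^+ 2.
Proof. by apply: ge_inf; [exists 0; exact: S2_ge0|exact: S2_unit]. Qed.

End neumann_eigenvalues.

(** * The explicit solution and its boundary integral *)

Section radial_solution.
Context {R : realType} (m : nat) (a b : 'rV[R]_m.+1).
Local Notation n := m.+1.
Hypothesis ab : forall i, a 0 i < b 0 i.

Let mbox : measurable (box a b) := measurable_box a b.
Let boxoo : (leb n (box a b) < +oo)%E := leb_box_lty a b.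

Definition half_length i : R := (b 0 i - a 0 i) / 2.
Definition midpoint i : R := (a 0 i + b 0 i) / 2.

Lemma half_length_gt0 i : 0 < half_length i.
Proof. by rewrite divr_gt0// subr_gt0. Qed.

Variable r : R.
Hypothesis r_gt0 : 0 < r.
Hypothesis sin_gt0 : forall i, 0 < sin (r * half_length i).

(** The one-dimensional solution of - p'' = r^2 p with outer derivative -1 at both ends. As a
    function of x_i alone it has zero normal derivative on the other faces, so the profiles add up
    to a solution on the box. *)
Definition profile i s : R :=
  (r * sin (r * half_length i))^-1 * cos (r * (s - midpoint i)).

(* Minus the derivative of [profile i]. *)
Definition flux i s : R := (sin (r * half_length i))^-1 * sin (r * (s - midpoint i)).

Lemma C1R_flux i : C1R (flux i) (fun s => r ^+ 2 * profile i s).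
Proof.
apply: eq_C1R (C1R_M (C1R_cst _) (C1R_comp C1R_sin (C1R_affine r (midpoint i)))) => s.
  by [].
rewrite /profile mul0r add0r; move: (cos _) => c.
by have := sin_gt0 i; move: (sin _) => t t0; field; rewrite !gt_eqF.
Qed.

Lemma C1R_profile i : C1R (profile i) (fun s => - flux i s).
Proof.
apply: eq_C1R (C1R_M (C1R_cst _) (C1R_comp C1R_cos (C1R_affine r (midpoint i)))) => s.
  by [].
rewrite /flux mul0r add0r; move: (sin (r * (s - _))) => c.
by have := sin_gt0 i; move: (sin _) => t t0; field; rewrite !gt_eqF.
Qed.

Let sub_midpoint_b i : b 0 i - midpoint i = half_length i.
Proof. by rewrite /midpoint /half_length; field. Qed.

Let sub_midpoint_a i : a 0 i - midpoint i = - half_length i.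
Proof. by rewrite /midpoint /half_length; field. Qed.

Lemma flux_b i : flux i (b 0 i) = 1.
Proof. by rewrite /flux sub_midpoint_b mulVf// gt_eqF. Qed.

Lemma flux_a i : flux i (a 0 i) = -1.
Proof. by rewrite /flux sub_midpoint_a mulrN sinN mulrN mulVf// gt_eqF. Qed.

Definition radial (x : 'rV[R]_n) : R := \sum_i profile i (x 0 i).

Lemma C1_radial : C1 radial.
Proof. by apply: C1_sum => i; exact: C1_coord (C1R_profile i). Qed.

Lemma partial_radial i : partial i radial = fun x => - flux i (x 0 i).
Proof.
rewrite /radial partial_sum; last by move=> j; exact: C1_coord (C1R_profile j).
apply/funext => x; rewrite (bigD1 i)//= (partial_coord _ _ (C1R_profile i)) eqxx mulr1n.
rewrite big1 ?addr0// => j ji.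
by rewrite (partial_coord _ _ (C1R_profile j)) eq_sym (negbTE ji).
Qed.

(** The field - grad [radial] is itself a normal field, equal to the outer normal on the boundary,
    with divergence r^2 [radial]. The formula is thus the weak equation of [radial] tested with u,
    for any trace g of u. *)
Lemma boundary_int_trace_radial u g : H1 a b u -> is_trace a b u g ->
  boundary_int a b g = r ^+ 2 * \int[leb n]_(x in box a b) (u x * radial x) -
    dirichlet_form a b u radial.
Proof.
move=> uH ug; rewrite (boundary_int_trace ab C1R_flux flux_a flux_b uH ug).
rewrite (dirichlet_form_C1 ab uH C1_radial) big_split/= addrC; congr (_ + _).
  have up i : (leb n).-integrable (box a b) (EFin \o (fun x => u x * profile i (x 0 i))).
    exact: (sqi_mul mbox uH.1 (C1_L2 a b (C1_coord i (C1R_profile i)))).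
  under [in RHS]eq_Rintegral do rewrite mulr_sumr.
  rewrite Rintegral_sum// mulr_sumr; apply: eq_bigr => i _.
  by rewrite -RintegralZl//; apply: eq_Rintegral => x _; ring.
rewrite -sumrN; apply: eq_bigr => i _; rewrite partial_radial.
have rad2 : L2 a b (fun x => - flux i (x 0 i)).
  by rewrite -partial_radial; exact: C1_partial_L2 C1_radial.
rewrite -[RHS]mulN1r -RintegralZl//; last first.
  exact: (sqi_mul mbox (grad_L2 i uH) rad2).
by apply: eq_Rintegral => x _; ring.
Qed.

Lemma boundary_int_radial :
  r ^+ 2 * boundary_int a b radial =
  \sum_i (2 * face_volume a b i * (r * cos (r * half_length i) / sin (r * half_length i)) +
     \sum_(j | j != i) 2 * face_volume a b j / half_length i).
Proof.
(* The affine normal field replaces [flux] here: its divergence is constant, so only integrals of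
   single profiles occur, not quadratic ones. *)
pose F i s := (half_length i)^-1 * (s - midpoint i).
have CF i : C1R (F i) (fun=> (half_length i)^-1) by exact: C1R_affine.
have h0 i : half_length i != 0 by rewrite gt_eqF// half_length_gt0.
have Fa i : F i (a 0 i) = -1 by rewrite /F sub_midpoint_a mulrN mulVf.
have Fb i : F i (b 0 i) = 1 by rewrite /F sub_midpoint_b mulVf.
rewrite (boundary_int_C1 ab CF Fa Fb C1_radial) mulr_sumr; apply: eq_bigr => i _.
have Ip j : r ^+ 2 * \int[leb n]_(x in box a b) profile j (x 0 j) = 2 * face_volume a b j.
  rewrite -RintegralZl//; last first.
    exact: (sqi_ig mbox boxoo (C1_L2 a b (C1_coord j (C1R_profile j)))).
  by rewrite (Rintegral_box_coord ab j (C1R_flux j)) flux_a flux_b; ring.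
have pi' j : (leb n).-integrable (box a b) (EFin \o (fun x : 'rV[R]_n => profile j (x 0 j))).
  exact: (sqi_ig mbox boxoo (C1_L2 a b (C1_coord j (C1R_profile j)))).
have E2 : \int[leb n]_(x in box a b) (radial x * (half_length i)^-1) =
    (half_length i)^-1 * \sum_j \int[leb n]_(x in box a b) profile j (x 0 j).
  rewrite RintegralZr//; last exact: (sqi_ig mbox boxoo (C1_L2 a b C1_radial)).
  by rewrite mulrC Rintegral_sum.
(* Integrating the derivative of [profile i] times [F i] gives the endpoint values behind the
   cotangent term; the remaining integral of [profile i] cancels the i-th term of [E2]. *)
have E1 : \int[leb n]_(x in box a b) (partial i radial x * F i (x 0 i)) =
   face_volume a b i * (profile i (b 0 i) + profile i (a 0 i)) -
   (half_length i)^-1 * \int[leb n]_(x in box a b) profile i (x 0 i).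
  have := Rintegral_box_coord ab i (C1R_M (C1R_profile i) (CF i)).
  rewrite Fa Fb mulr1 mulrN1 opprK => <-.
  have c1 : (leb n).-integrable (box a b) (EFin \o (fun x : 'rV[R]_n =>
      - flux i (x 0 i) * F i (x 0 i) + profile i (x 0 i) * (half_length i)^-1)).
    apply: continuous_ig_box => x.
    exact: (cvg_comp _ _ (@coord_continuous _ _ _ 0 i x) ((C1R_M (C1R_profile i) (CF i)).2 (x 0 i))).
  have z1 := igZ mbox (half_length i)^-1 (pi' i).
  rewrite -RintegralZl// -RintegralB//.
  by apply: eq_Rintegral => x _; rewrite partial_radial; ring.
have := Ip i; rewrite E1 E2 (bigD1 i)//= => Ipi.
rewrite [_ * (_ + \sum_(_ | _) _)]mulrDr addrA subrK mulrDr; congr (_ + _).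
  rewrite /profile sub_midpoint_b sub_midpoint_a mulrN cosN.
  have := sin_gt0 i; move: (sin _) => t t0.
  by field; rewrite !gt_eqF.
rewrite !mulr_sumr; apply: eq_bigr => j _.
by rewrite -(Ip j); ring.
Qed.

End radial_solution.

(** * Maclaurin's inequality *)

Section maclaurin.
Context {R : realType}.
Implicit Types (x y s t : R) (k n : nat).

Lemma AGM_one_vs_many x y k : 0 <= x -> 0 < y ->
  x * y ^+ k <= ((x + k%:R * y) / k.+1%:R) ^+ k.+1.
Proof.
(* After division by y^(k+1) the inequality is Bernoulli's, 1 + (k + 1) z <= (1 + z)^(k+1), with z
   >= -1 because x >= 0. *)
move=> x0 y0; pose z := (x / y - 1) / k.+1%:R.
have k0 : 0 < k.+1%:R :> R by [].
have zE : (x + k%:R * y) / k.+1%:R = y * (1 + z).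
  rewrite /z -natr1; field; rewrite (gt_eqF y0) /=.
  by rewrite natr1 pnatr_eq0.
rewrite zE exprMn exprS [leRHS]mulrAC -ler_pdivrMr ?exprn_gt0// mulfK ?gt_eqF ?exprn_gt0//.
rewrite mulrC -ler_pdivrMr//.
have -> : x / y = 1 + k.+1%:R * z by rewrite /z [k.+1%:R * _]mulrC divfK ?gt_eqF// addrC subrK.
have [z0|z0] := leP 0 z; first exact: bernoulli_ge.
have := @bernoulli_le R (- z) k.+1; rewrite mulrN !opprK; apply.
rewrite oppr_ge0 (ltW z0)/= lerNl /z ler_pdivlMr// mulN1r.
rewrite lerBrDr -natr1 opprD addrNK (@le_trans _ _ 0) ?oppr_le0//.
by rewrite divr_ge0// ltW.
Qed.

Let S (x : nat -> R) n := \sum_(i < n) x i.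
Let T (x : nat -> R) n := \sum_(i < n) x i ^+ 2.

Lemma sqr_sum_le (x : nat -> R) n : S x n ^+ 2 <= n%:R * T x n.
Proof.
rewrite /S /T; elim: n => [|n IH]; first by rewrite !big_ord0 expr0n mul0r.
case: n IH => [|n] IH; first by rewrite !big_ord1 mul1r.
rewrite 2!(big_ord_recr n.+1)/=.
move: (\sum_(i < n.+1) _) (\sum_(i < n.+1) _) (x n.+1) IH => t s y IH.
have N0 : 0 < n.+1%:R :> R by [].
rewrite -natr1; move: (n.+1%:R) N0 IH => N N0 IH.
have h : 2 * s * y <= t + N * y ^+ 2.
  rewrite -(ler_pM2l N0); have := sqr_ge0 (s - N * y).
  have -> : (s - N * y) ^+ 2 = s ^+ 2 - N * (2 * s * y) + N ^+ 2 * y ^+ 2 by ring.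
  have -> : N * (t + N * y ^+ 2) = N * t + N ^+ 2 * y ^+ 2 by ring.
  move=> h; rewrite -subr_ge0.
  rewrite (_ : _ - _ = (N * t - s ^+ 2) + (s ^+ 2 - N * (2 * s * y) + N ^+ 2 * y ^+ 2)).
    by apply: addr_ge0 => //; rewrite subr_ge0.
  by ring.
have -> : (s + y) ^+ 2 = s ^+ 2 + 2 * s * y + y ^+ 2 by ring.
have -> : (N + 1) * (t + y ^+ 2) = N * t + (t + N * y ^+ 2) + y ^+ 2 by ring.
by lra.
Qed.

Lemma sum_sqr_le (x : nat -> R) n : (forall i, 0 < x i) -> T x n <= S x n ^+ 2.
Proof.
move=> x0; elim: n => [|n IH]; first by rewrite /S /T !big_ord0 expr0n.
have S0 : 0 <= S x n by apply: sumr_ge0 => i _; exact: ltW.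
rewrite /S /T !big_ord_recr/= -/(S x n) -/(T x n) sqrrD lerD2r (le_trans IH)// lerDl.
by rewrite mulrn_wge0// mulr_ge0// ltW.
Qed.

(* Maclaurin's inequality between the last two elementary symmetric means of
   the reciprocals of the x i, written with the first two means of the x i. *)
Lemma maclaurin (x : nat -> R) n : (forall i, 0 < x i) ->
  (S x n.+2 / n.+2%:R) ^+ n * \prod_(i < n.+2) x i <=
  ((S x n.+2 ^+ 2 - T x n.+2) / (n.+2%:R * n.+1%:R)) ^+ n.+1.
Proof.
move=> x0; elim: n => [|n IH].
  rewrite /S /T !big_ord_recr !big_ord0 /= expr0 expr1 !mul1r !add0r.
  by rewrite le_eqVlt; apply/orP; left; apply/eqP; field.
have Sn : S x n.+3 = S x n.+2 + x n.+2 by rewrite /S big_ord_recr.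
have Tn : T x n.+3 = T x n.+2 + x n.+2 ^+ 2 by rewrite /T big_ord_recr.
rewrite Sn Tn [in leLHS]big_ord_recr [leLHS]/=.
have CS := sqr_sum_le x n.+2; have CS' := sum_sqr_le n.+2 x0.
have S0 : 0 < S x n.+2.
  by rewrite /S big_ord_recl/= ltr_wpDr ?x0// sumr_ge0// => i _; exact: ltW.
have Q0 : 0 < \prod_(i < n.+2) x i by rewrite prodr_gt0.
move: (S x n.+2) (T x n.+2) (\prod_(i < n.+2) x i) (x n.+2) (x0 n.+2) IH CS CS' S0 Q0.
move=> s0 t0 Q y y0 IH CS CS' S0 Q0.
pose N : R := n.+2%:R.
have N0 : 0 < N by [].
have N1 : n.+1%:R = N - 1 :> R by rewrite /N -[n.+2%:R]natr1 addrK.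
have N3 : n.+3%:R = N + 1 :> R by rewrite /N natr1.
have N10 : 0 < N - 1 by rewrite -N1.
rewrite N1 -/N in IH; rewrite N3 -/N; rewrite -/N in CS.
pose s := s0 / N.
have s_gt0 : 0 < s by rewrite divr_gt0.
have s0E : s0 = N * s by rewrite /s mulrC divfK// gt_eqF.
pose t := (s0 ^+ 2 - t0) / (N * (N - 1)).
have t0E : t0 = N ^+ 2 * s ^+ 2 - N * (N - 1) * t.
  by rewrite /t s0E; field; rewrite !gt_eqF.
rewrite -/s -/t in IH.
have t_gt0 : 0 < t.
  have := lt_le_trans (mulr_gt0 (exprn_gt0 n s_gt0) Q0) IH.
  have t0' : 0 <= t.
    by rewrite divr_ge0 ?subr_ge0// ltW// mulr_gt0.
  move=> h; rewrite lt_neqAle t0' andbT; apply: contraTneq h => <-.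
  by rewrite expr0n ltxx.
have ts : t <= s ^+ 2.
  move: CS; rewrite s0E t0E => CS.
  have : N * (N - 1) * N * t <= N * (N - 1) * N * s ^+ 2 by lra.
  by rewrite ler_pM2l// !mulr_gt0.
pose s1 := (N * s + y) / (N + 1).
have s1_gt0 : 0 < s1 by rewrite divr_gt0 ?addr_gt0// mulr_gt0.
pose A1 := ((N - 1) * t + 2 * s * y) / (N + 1).
rewrite (_ : ((s0 + y) ^+ 2 - _) / _ = A1); last first.
  by rewrite /A1 s0E t0E; field; rewrite !gt_eqF// addr_gt0.
rewrite (_ : (s0 + y) / _ = s1); last by rewrite /s1 s0E.
(* Here s, t are the first two symmetric means before y is added, and s1, A1 those after. The
   induction hypothesis s^n Q <= t^(n+1) turns the left-hand side s1^(n+1) y Q into at most (y s)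
   z^(n+1), to which the inequality of the means applies. *)
pose z := s1 * t / s.
have z_gt0 : 0 < z by rewrite divr_gt0// mulr_gt0.
apply: (@le_trans _ _ ((y * s) * z ^+ n.+1)).
  rewrite /z (exprMn _ (s1 * t)) (exprMn _ s1) exprVn.
  rewrite (_ : y * s * _ = s1 ^+ n.+1 * y * (t ^+ n.+1 / s ^+ n)); last first.
    by rewrite [s ^+ n.+1]exprS; field; rewrite expf_neq0 gt_eqF.
  rewrite [leLHS](_ : _ = s1 ^+ n.+1 * y * Q); last by ring.
  rewrite ler_wpM2l ?mulr_ge0 ?exprn_ge0 ?(ltW y0) ?(ltW s1_gt0)//.
  by rewrite ler_pdivlMr ?exprn_gt0// mulrC.
apply: le_trans (AGM_one_vs_many n.+1 _ z_gt0) _; first by rewrite mulr_ge0 ?ltW.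
have LHS0 : 0 <= (y * s + n.+1%:R * z) / n.+2%:R.
  by rewrite divr_ge0// addr_ge0// mulr_ge0// ltW.
suff le : (y * s + n.+1%:R * z) / n.+2%:R <= A1.
  by rewrite lerXn2r// nnegrE// (le_trans LHS0).
rewrite N1 -/N -subr_ge0.
(* The arithmetic mean of y s and n + 1 copies of z falls short of A1 by a multiple of s^2 - t,
   nonnegative by Cauchy-Schwarz. *)
rewrite (_ : _ - _ = (N - 1) * y * (s ^+ 2 - t) / (N * (N + 1) * s)).
  rewrite divr_ge0//; last by apply/ltW/(mulr_gt0 _ s_gt0)/(mulr_gt0 N0); rewrite -N3.
  by apply: mulr_ge0; [apply: mulr_ge0; exact: ltW|rewrite subr_ge0].
by rewrite /A1 /z /s1; field; rewrite !gt_eqF// addr_gt0.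
Qed.

(** Dividing by the product of the x_i turns means of the x_i of degrees 1 and 2 into means of their
    reciprocals of complementary degrees, and makes both sides pure powers, of exponents n and n +
    1. *)
Lemma maclaurin_powR (x : nat -> R) n : (forall i, 0 < x i) ->
  (S x n.+2 / (n.+2%:R * \prod_(i < n.+2) x i)) `^ ((n.+2%:R - 2) / (n.+2%:R - 1)) <=
  (S x n.+2 ^+ 2 - T x n.+2) / (n.+2%:R * (n.+2%:R - 1) * \prod_(i < n.+2) x i).
Proof.
move=> x0; set Q := \prod_(i < n.+2) x i; have Q0 : 0 < Q by rewrite prodr_gt0.
have n1 : n.+2%:R - 1 = n.+1%:R :> R by rewrite -natr1 addrK.
have n2 : n.+2%:R - 2 = n%:R :> R by rewrite -addn2 natrD addrK.
rewrite n1 n2.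
have E1 : S x n.+2 / (n.+2%:R * Q) = S x n.+2 / n.+2%:R / Q by rewrite invfM mulrA.
have E2 : (S x n.+2 ^+ 2 - T x n.+2) / (n.+2%:R * n.+1%:R * Q) =
   (S x n.+2 ^+ 2 - T x n.+2) / (n.+2%:R * n.+1%:R) / Q by rewrite [in LHS]invfM mulrA.
have M := maclaurin n x0; rewrite -/Q in M.
rewrite E1 E2.
have A0 : 0 <= (S x n.+2 ^+ 2 - T x n.+2) / (n.+2%:R * n.+1%:R).
  by rewrite divr_ge0 ?mulr_ge0// subr_ge0 sum_sqr_le.
have B0 : 0 <= S x n.+2 / n.+2%:R.
  by rewrite divr_ge0// sumr_ge0// => i _; exact: ltW.
move: (_ / (_ * _)) (S x n.+2 / _) M A0 B0 => A B M A0 B0.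
have Qn : Q != 0 by rewrite gt_eqF.
have AQ0 : 0 <= A / Q by rewrite divr_ge0// ltW.
have BQ0 : 0 <= B / Q by rewrite divr_ge0// ltW.
have M' : (B / Q) ^+ n <= (A / Q) ^+ n.+1.
  rewrite !exprMn !exprVn ler_pdivrMr ?exprn_gt0//.
  have -> : A ^+ n.+1 / Q ^+ n.+1 * Q ^+ n = A ^+ n.+1 / Q.
    by rewrite [Q ^+ n.+1]exprS; field; rewrite Qn expf_neq0.
  by rewrite ler_pdivlMr.
rewrite powRrM powR_mulrn//.
apply: (@le_trans _ _ (((A / Q) ^+ n.+1) `^ n.+1%:R^-1)).
  by apply: ge0_ler_powR => //; rewrite nnegrE exprn_ge0.
by rewrite -powR_mulrn// -powRrM mulfV// powRr1.
Qed.

End maclaurin.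

(** * Weak solutions agree with the explicit one up to single cosines *)

Section weak_solutions.
Context {R : realType} (m : nat) (a b : 'rV[R]_m.+1).
Local Notation n := m.+1.
Hypothesis ab : forall i, a 0 i < b 0 i.
Implicit Types (u v w g : 'rV[R]_n -> R) (k : 'I_n -> nat).

Let mbox : measurable (box a b) := measurable_box a b.
Let boxoo : (leb n (box a b) < +oo)%E := leb_box_lty a b.

Lemma eq_boundary_int_trace u g g' : H1 a b u -> is_trace a b u g ->
  is_trace a b u g' -> boundary_int a b g = boundary_int a b g'.
Proof.
move=> uH ug ug'; pose F i s := (half_length a b i)^-1 * (s - midpoint a b i).
have CF i : C1R (F i) (fun=> (half_length a b i)^-1) by exact: C1R_affine.
have Fa i : F i (a 0 i) = -1.
  by rewrite /F /midpoint /half_length; field; rewrite subr_eq0 gt_eqF.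
have Fb i : F i (b 0 i) = 1.
  by rewrite /F /midpoint /half_length; field; rewrite subr_eq0 gt_eqF.
by rewrite (boundary_int_trace ab CF Fa Fb uH ug) (boundary_int_trace ab CF Fa Fb uH ug').
Qed.

Lemma boundary_int_trace_C1 v : C1 v ->
  boundary_int a b (trace a b v) = boundary_int a b v.
Proof.
move=> Cv; have vH := C1_H1 ab Cv.
have tv : is_trace a b v v by exact: (is_trace_C1 ab vH Cv (aeW _ (fun x _ => erefl))).
exact: (eq_boundary_int_trace vH (is_trace_trace tv) tv).
Qed.

Lemma perimeterE : perimeter a b = \sum_i 2 * face_volume a b i.
Proof.
apply: eq_bigr => i _.
rewrite Rintegral_cst; last exact: measurable_box.
by rewrite mul1r mulr_natl mulr2n.
Qed.

Lemma perimeter_gt0 : 0 < perimeter a b.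
Proof.
rewrite perimeterE big_ord_recl/= ltr_wpDr// ?mulr_gt0 ?face_volume_gt0//.
by apply: sumr_ge0 => i _; rewrite mulr_ge0// ltW// face_volume_gt0.
Qed.

(** The constant test function leaves only the perimeter, which is positive. This rules out mu_2 =
    0. *)
Lemma no_weak_solution0 u : ~ weak_solution a b 0 u.
Proof.
move=> [uH /(_ _ (C1_H1 ab (C1_cosprod a b (fun=> 0%N))))].
rewrite (dirichlet_form_cosprod ab _ uH) /eigval big1 ?mul0r ?add0r; last first.
  by move=> j _; rewrite mul0r expr0n.
rewrite (boundary_int_trace_C1 (C1_cosprod _ _ _)) cosprod0 => P0.
by have := perimeter_gt0; rewrite /perimeter P0 ltxx.
Qed.

Lemma neumann_eigenvalue2_gt0 u :
  weak_solution a b (neumann_eigenvalue a b 2) u -> 0 < neumann_eigenvalue a b 2.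
Proof.
move=> uS; rewrite lt_neqAle (neumann_eigenvalue2_ge0 ab) andbT.
by apply/eqP => mu0; move: uS; rewrite -mu0; exact: no_weak_solution0.
Qed.

(** A nonzero k_i alone contributes at least kappa_i^2 >= mu_2, which leaves room for nothing else:
    k_i = 1 and the other indices vanish. *)
Lemma eigval_le_eigenvalue2 k : 0 < eigval a b k -> eigval a b k <= neumann_eigenvalue a b 2 ->
  exists i, k = unit_index i.
Proof.
move=> k_gt0 k_le.
have [i ki] : exists i, k i != 0%N.
  apply: contrapT => /forallNP k0; move: k_gt0; rewrite /eigval big1 ?ltxx// => j _.
  by have /negP := k0 j; rewrite negbK => /eqP ->; rewrite mul0r expr0n.
exists i; have kap0 := kappa_gt0 ab.
have := le_trans k_le (neumann_eigenvalue2_le ab i).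
rewrite /eigval (bigD1 i)//= => le1.
have ki1 : 1 <= (k i)%:R :> R by rewrite ler1n lt0n.
have kk0 : 0 <= (k i)%:R * kappa a b i by rewrite mulr_ge0// ltW.
have le2 : kappa a b i ^+ 2 <= ((k i)%:R * kappa a b i) ^+ 2.
  apply: lerXn2r; [|exact: kk0|]; rewrite ?nnegrE ?ler_peMl//; exact: ltW.
have s0 : 0 <= \sum_(j < n | j != i) ((k j)%:R * kappa a b j) ^+ 2.
  by apply: sumr_ge0 => j _; exact: sqr_ge0.
have s1 : \sum_(j < n | j != i) ((k j)%:R * kappa a b j) ^+ 2 = 0.
  by apply/eqP; rewrite eq_le s0 andbT; lra.
have ki_eq : k i = 1%N.
  apply/eqP; rewrite eqn_leq lt0n ki andbT.
  have : ((k i)%:R * kappa a b i) ^+ 2 <= kappa a b i ^+ 2 by lra.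
  rewrite ler_pXn2r ?nnegrE// ?(ltW (kap0 i))//.
  by rewrite ger_pMl// lern1.
apply/funext => j; rewrite /unit_index; have [->//|ji] := eqVneq j i.
have := psumr_eq0P (fun j _ => sqr_ge0 ((k j)%:R * kappa a b j)) s1 ji.
move/eqP; rewrite sqrf_eq0 mulf_eq0 (gt_eqF (kap0 j)) orbF pnatr_eq0.
by move/eqP.
Qed.

Lemma unit_index_inj : injective (@unit_index m).
Proof.
move=> i j /(congr1 (fun k => k i)); rewrite /unit_index eqxx.
by case: eqP.
Qed.

Section explicit.
Variables (r : R) (u : 'rV[R]_n -> R).
Hypothesis r_gt0 : 0 < r.
Hypothesis sin_gt0 : forall i, 0 < sin (r * half_length a b i).
Hypothesis r_le : r ^+ 2 <= neumann_eigenvalue a b 2.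
Hypothesis uS : weak_solution a b (r ^+ 2) u.

Let w := radial a b r.
Let Cw : C1 w := C1_radial r_gt0 sin_gt0.
Let uH : H1 a b u := uS.1.
Let u2 : L2 a b u := uH.1.
Let w2 : L2 a b w := C1_L2 a b Cw.
Let phi2 k : L2 a b (cosprod a b k) := C1_L2 a b (C1_cosprod a b k).
Let uw2 : L2 a b (fun x => u x - w x) := sqiB mbox u2 w2.
Let pairing v k := \int[leb n]_(x in box a b) (v x * cosprod a b k x).

Let pairing_sub k : pairing (fun x => u x - w x) k = pairing u k - pairing w k.
Proof.
rewrite /pairing -RintegralB//; last 2 first.
- exact: (sqi_mul mbox u2 (phi2 k)).
- exact: (sqi_mul mbox w2 (phi2 k)).
by apply: eq_Rintegral => x _; rewrite mulrBl.
Qed.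

(** Both u and w satisfy the weak equation for this test function, with the same boundary term,
    which cancels in the difference. *)
Let pairing_eq0 k : (r ^+ 2 - eigval a b k) * pairing (fun x => u x - w x) k = 0.
Proof.
have Cphi := C1_cosprod a b k; have phiH := C1_H1 ab Cphi.
have tphi : is_trace a b (cosprod a b k) (cosprod a b k).
  exact: (is_trace_C1 ab phiH Cphi (aeW _ (fun x _ => erefl))).
have := uS.2 _ phiH.
rewrite (dirichlet_form_cosprod ab k uH).
rewrite (boundary_int_trace_radial ab r_gt0 sin_gt0 phiH (is_trace_trace tphi)).
rewrite dirichlet_formC (dirichlet_form_cosprod ab k (C1_H1 ab Cw)) -/(pairing u k) -/(pairing w k).
have -> : \int[leb n]_(x in box a b) (cosprod a b k x * radial a b r x) = pairing w k.
  by apply: eq_Rintegral => x _; rewrite mulrC.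
rewrite pairing_sub; move: (pairing u k) (pairing w k) => p q E.
have -> : (r ^+ 2 - eigval a b k) * (p - q) =
  r ^+ 2 * p - (eigval a b k * p + (r ^+ 2 * q - eigval a b k * q)) by ring.
by rewrite E subrr.
Qed.

(** Projection coefficients of u - w on the single cosines. By [pairing_eq0] they vanish when r^2 <
    mu_2; keeping them treats r^2 = mu_2 at the same time. *)
Let alpha i := pairing (fun x => u x - w x) (unit_index i) /
  pairing (cosprod a b (unit_index i)) (unit_index i).

Let S x := w x + \sum_i alpha i * cosprod a b (unit_index i) x.

Let CS : C1 S.
Proof.
apply: (C1_D Cw); apply: C1_sum => i.
exact: (C1_M (C1_cst _ (alpha i)) (C1_cosprod a b _)).
Qed.

Let u_eq_S : {ae leb n, forall x, box a b x -> u x = S x}.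
Proof.
have d2 := sqiB mbox u2 (C1_L2 a b CS).
suff : {ae leb n, forall x, box a b x -> u x - S x = 0}.
  by apply: filterS => x h /h /eqP; rewrite subr_eq0 => /eqP.
apply: (cosines_total ab (sqi_ig mbox boxoo d2)) => k.
rewrite -/(cosprod a b k) (_ : \int[_]_(x in _) _ =
  \int[leb n]_(x in box a b) ((u x - w x) * cosprod a b k x -
     \sum_i alpha i * (cosprod a b (unit_index i) x * cosprod a b k x))); last first.
  apply: eq_Rintegral => x _; rewrite /S -/(cosprod a b k x) opprD addrA mulrBl mulr_suml.
  by congr (_ - _); apply: eq_bigr => i _; rewrite mulrA.
have pp i : (leb n).-integrable (box a b)
    (EFin \o (fun x => cosprod a b (unit_index i) x * cosprod a b k x)).
  exact: (sqi_mul mbox (phi2 _) (phi2 _)).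
have app i := igZ mbox (alpha i) (pp i).
rewrite RintegralB//; last 2 first.
- exact: (sqi_mul mbox uw2 (phi2 k)).
- exact: (ig_sum mbox _ app).
rewrite (Rintegral_sum mbox _ app).
have E i : \int[leb n]_(x in box a b)
    (alpha i * (cosprod a b (unit_index i) x * cosprod a b k x)) =
    alpha i * pairing (cosprod a b (unit_index i)) k by rewrite RintegralZl.
rewrite (eq_bigr _ (fun i _ => E i)) -/(pairing _ k).
(* For a single cosine the pairing vanishes by the choice of [alpha]; for any other index r^2 is not
   its eigenvalue, and [pairing_eq0] applies. *)
have [[i ki]|nk] := pselect (exists i, k = unit_index i).
  rewrite ki (bigD1 i)//= big1 ?addr0; last first.
    move=> j ji; rewrite /pairing (cosprod_orthogonal ab) ?mulr0// => /unit_index_inj e.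
    by rewrite e eqxx in ji.
  rewrite /alpha divfK ?subrr// /pairing.
  under eq_Rintegral do rewrite -expr2.
  by rewrite (cosprod_unit_norm ab) gt_eqF// divr_gt0// (volume_gt0 ab).
rewrite big1 ?subr0; last first.
  move=> j _; rewrite /pairing (cosprod_orthogonal ab) ?mulr0// => e.
  by apply: nk; exists j.
have /eqP := pairing_eq0 k; rewrite mulf_eq0 => /orP[|/eqP//].
rewrite subr_eq0 => /eqP rk; exfalso; apply: nk.
by apply: eigval_le_eigenvalue2; rewrite -rk// exprn_gt0.
Qed.

Lemma boundary_int_weak_solution :
  boundary_int a b (trace a b u) = boundary_int a b (radial a b r).
Proof.
have tu := is_trace_trace (is_trace_C1 ab uH CS u_eq_S).
rewrite (boundary_int_trace_radial ab r_gt0 sin_gt0 uH tu).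
rewrite -(uS.2 _ (C1_H1 ab Cw)) addrC addKr.
exact: boundary_int_trace_C1.
Qed.

End explicit.
End weak_solutions.

(** * The value of c times the boundary integral, for 0 < c <= mu_2 *)

Section box_flux.
Context {R : realType} (m : nat) (a b : 'rV[R]_m.+1).
Local Notation n := m.+1.
Hypothesis ab : forall i, a 0 i < b 0 i.

Definition flux_value (r : R) : R :=
  \sum_i (2 * face_volume a b i * (r * cos (r * half_length a b i) / sin (r * half_length a b i)) +
     \sum_(j | j != i) 2 * face_volume a b j / half_length a b i).

(** The square root of c is at most kappa_i, and kappa_i L_i = pi / 2. So the sines are positive,
    and the cosines are nonnegative up to the endpoint. *)
Lemma frequency_bounds (c : R) i : 0 < c <= neumann_eigenvalue a b 2 ->
  0 < Num.sqrt c * half_length a b i <= pi / 2.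
Proof.
move=> /andP[c0 cmu]; rewrite mulr_gt0 ?sqrtr_gt0 ?half_length_gt0//=.
have h : Num.sqrt c <= kappa a b i.
  rewrite -(ger0_norm (ltW (kappa_gt0 ab i))) -sqrtr_sqr ler_wsqrtr//.
  exact: le_trans cmu (neumann_eigenvalue2_le ab i).
apply: (@le_trans _ _ (kappa a b i * half_length a b i)).
  by rewrite ler_wpM2r// ltW// half_length_gt0.
rewrite le_eqVlt; apply/orP; left; apply/eqP; rewrite /kappa /half_length; field.
by rewrite subr_eq0 gt_eqF.
Qed.

Lemma sin_frequency_gt0 (c : R) i : 0 < c <= neumann_eigenvalue a b 2 ->
  0 < sin (Num.sqrt c * half_length a b i).
Proof.
move=> c_itv; have /andP[h1 h2] := frequency_bounds i c_itv; apply: sin_gt0_pi; rewrite h1/=.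
by apply: le_lt_trans h2 _; rewrite ltr_pdivrMr// ltr_pMr ?pi_gt0// ltr1n.
Qed.

Lemma weak_solution_flux (c : R) u : 0 < c <= neumann_eigenvalue a b 2 ->
  weak_solution a b c u ->
  c * boundary_int a b (trace a b u) = flux_value (Num.sqrt c).
Proof.
move=> c_itv uS; have /andP[c0 cmu] := c_itv.
have r0 : 0 < Num.sqrt c by rewrite sqrtr_gt0.
have cE : c = Num.sqrt c ^+ 2 by rewrite sqr_sqrtr// ltW.
have sin0 i := sin_frequency_gt0 i c_itv.
have cmu' : Num.sqrt c ^+ 2 <= neumann_eigenvalue a b 2 by rewrite -cE.
have uS' : weak_solution a b (Num.sqrt c ^+ 2) u by rewrite -cE.
rewrite (boundary_int_weak_solution ab r0 sin0 cmu' uS').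
transitivity (Num.sqrt c ^+ 2 * boundary_int a b (radial a b (Num.sqrt c))).
  by rewrite -cE.
exact: (boundary_int_radial ab r0 sin0).
Qed.

Lemma continuous_flux_value (c : R) : 0 < c <= neumann_eigenvalue a b 2 ->
  {for c, continuous (fun c => flux_value (Num.sqrt c))}.
Proof.
move=> c_itv; rewrite /flux_value.
have cs : {for c, continuous (fun c : R => Num.sqrt c)} by exact: sqrt_continuous.
apply: cvg_big => [|i _]; first exact: add_continuous.
apply: cvgD; last exact: cvg_cst.
apply: cvgM; first exact: cvg_cst.
have cl : {for c, continuous (fun c : R => Num.sqrt c * half_length a b i)}.
  by apply: cvgM; [exact: cs|exact: cvg_cst].
apply: cvgM.
  apply: cvgM; first exact: cs.
  exact: (cvg_comp _ _ cl (@continuous_cos R _)).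
apply: cvgV; first by rewrite gt_eqF// sin_frequency_gt0.
exact: (cvg_comp _ _ cl (@continuous_sin R _)).
Qed.

End box_flux.

(** * The lower bound in terms of the perimeter *)

Section flux_lower_bound.
Context {R : realType} (m : nat) (a b : 'rV[R]_m.+2).
Local Notation n := m.+2.
Hypothesis ab : forall i, a 0 i < b 0 i.

(** Maclaurin's inequality is stated for sequences on [nat] that are positive everywhere; [inord]
    supplies a valid coordinate also beyond the dimension. *)
Let x (k : nat) : R := (half_length a b (inord k))^-1.

Let x_gt0 k : 0 < x k.
Proof. by rewrite invr_gt0 half_length_gt0. Qed.

Let xE (i : 'I_n) : x i = (half_length a b i)^-1.
Proof. by rewrite /x inord_val. Qed.

Let face_volumeE i : 2 * face_volume a b i = volume a b * x i.
Proof.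
rewrite (volumeE ab i) xE /half_length; field.
by rewrite subr_eq0 gt_eqF.
Qed.

Let volume_prod : volume a b = 2 ^+ n / \prod_(i < n) x i.
Proof.
rewrite /volume leb_box => [/=|i]; last exact: ltW.
rewrite (eq_bigr (fun i : 'I_n => 2 * (x i)^-1)).
  by rewrite big_split/= prodfV prodr_const card_ord.
by move=> i _; rewrite xE invrK /half_length mulrC divfK// pnatr_eq0.
Qed.

Lemma perimeter_half_length :
  perimeter a b = volume a b * \sum_(i < n) x i.
Proof. by rewrite perimeterE mulr_sumr; apply: eq_bigr => i _; exact: face_volumeE. Qed.

Lemma flux_value_ge (r : R) : 0 < r ->
  (forall i, 0 < r * half_length a b i <= pi / 2) ->
  2 ^+ n * n%:R * (n%:R - 1) *
    (perimeter a b / (n%:R * 2 ^+ n)) `^ ((n%:R - 2) / (n%:R - 1)) <=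
  flux_value a b r.
Proof.
move=> r0 rl.
have Q0 : 0 < \prod_(i < n) x i by rewrite prodr_gt0.
have n0 : n%:R != 0 :> R by rewrite pnatr_eq0.
have n1 : n%:R - 1 != 0 :> R by rewrite -natr1 addrK pnatr_eq0.
have p0 : 2 ^+ n != 0 :> R by rewrite expf_neq0// pnatr_eq0.
have arg_simpl (N p Q s : R) : N != 0 -> p != 0 -> Q != 0 ->
    p / Q * s / (N * p) = s / (N * Q).
  by move=> *; field; apply/and3P.
have bound_simpl (N M p Q s : R) : N != 0 -> M != 0 -> Q != 0 ->
    p * N * M * (s / (N * M * Q)) = p / Q * s.
  by move=> *; field; apply/and3P.
(* The middle term is V times the sum of x_i x_j over i != j, that is, [flux_value] without its
   cotangent terms. *)
apply: (@le_trans _ _ (volume a b * ((\sum_(i < n) x i) ^+ 2 - \sum_(i < n) x i ^+ 2))).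
  rewrite perimeter_half_length volume_prod.
  rewrite arg_simpl ?gt_eqF//.
  apply: (le_trans (ler_wpM2l _ (maclaurin_powR m x_gt0))).
    by rewrite mulr_ge0// ?mulr_ge0 ?exprn_ge0// -natr1 addrK.
  by rewrite bound_simpl ?gt_eqF.
rewrite /flux_value big_split/=.
apply: (@le_trans _ _ (\sum_(i < n) \sum_(j < n | j != i) 2 * face_volume a b j / half_length a b i)).
  rewrite le_eqVlt; apply/orP; left; apply/eqP.
  rewrite expr2 mulr_suml -sumrB mulr_sumr; apply: eq_bigr => i _.
  rewrite (bigD1 i)//= (_ : _ - _ = x i * \sum_(j < n | j != i) x j); last by ring.
  rewrite mulrA mulr_sumr.
  by apply: eq_bigr => j _; rewrite face_volumeE -xE; ring.
rewrite lerDr; apply: sumr_ge0 => i _; have /andP[h1 h2] := rl i.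
rewrite mulr_ge0//; first by rewrite mulr_ge0// ltW// face_volume_gt0.
have pi0 : pi / 2 < pi :> R by rewrite ltr_pdivrMr// ltr_pMr ?pi_gt0// ltr1n.
rewrite divr_ge0//; last by rewrite ltW// sin_gt0_pi// h1/= (le_lt_trans h2).
rewrite mulr_ge0 ?(ltW r0)//; apply: cos_ge0_pihalf; rewrite h2 andbT.
by rewrite (le_trans _ (ltW h1))// oppr_le0 divr_ge0// pi_ge0.
Qed.

End flux_lower_bound.

Theorem corollary4p1 (R : realType) (n : nat) (n_ge2 : (2 <= n)%N)
    (a b : 'rV[R]_n) (a_lt_b : forall i, a 0 i < b 0 i)
    (mu2 : R) (mu2E : mu2 = neumann_eigenvalue a b 2)
    (u : R -> 'rV[R]_n -> R)
    (u_sol : forall c, 0 < c -> c < mu2 -> weak_solution a b c (u c))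
    (u_mu2 : 'rV[R]_n -> R) (u_mu2_sol : weak_solution a b mu2 u_mu2) :
  (c * boundary_int a b (trace a b (u c))) @[c --> mu2^'-] -->
    mu2 * boundary_int a b (trace a b u_mu2) /\
  mu2 * boundary_int a b (trace a b u_mu2) >=
    2 ^+ n * n%:R * (n%:R - 1) *
    (perimeter a b / (n%:R * 2 ^+ n)) `^ ((n%:R - 2) / (n%:R - 1)).
Proof.
case: n n_ge2 a b a_lt_b mu2E u u_sol u_mu2 u_mu2_sol => [//|[//|m]] _ a b ab mu2E u u_sol u_mu2 u_mu2_sol.
have mu2_gt0 : 0 < mu2.
  by move: u_mu2_sol; rewrite mu2E; exact: neumann_eigenvalue2_gt0.
have mu2_itv : 0 < mu2 <= neumann_eigenvalue a b 2 by rewrite mu2_gt0 -mu2E lexx.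
rewrite (weak_solution_flux ab mu2_itv u_mu2_sol); split; last first.
  apply: flux_value_ge => //; first by rewrite sqrtr_gt0.
  by move=> i; exact: frequency_bounds.
(* Just below mu_2 the function of c agrees with [flux_value (Num.sqrt c)], whose left limit is its
   value at mu_2. *)
have := cvg_at_left_filter (continuous_flux_value ab mu2_itv).
apply: cvg_trans; apply: near_eq_cvg; near=> c.
have c0 : 0 < c by near: c; exact: nbhs_left_gt.
have cmu : c < mu2 by near: c; exact: nbhs_left_lt.
rewrite -(weak_solution_flux ab _ (u_sol c c0 cmu))//.
by rewrite c0 -mu2E ltW.
Unshelve. all: by end_near. Qed.
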